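(* For every $\gamma\geqslant0$ there exists a constant $c(\gamma)>0$ depending only on $\gamma$ such that the following holds. Let $\sigma_m^2$, $m=1,2,\dots$, be positive numbers with $$\sigma_1^2\geqslant\sigma_2^2\geqslant\cdots\geqslant\sigma_m^2\geqslant\cdots\quad\text{and}\quad\sum_{m=1}^\infty\sigma_m^2<\infty .$$ Let $n$ be a positive integer and let $\lambda>0$ satisfy $\sigma_1^2\leqslant\lambda^2$. Put $$k=\min\{m\geqslant1:\ n\,\sigma_m^2<\lambda^2\}-1,\qquad B_k^2=\sum_{m=k+1}^\infty\sigma_m^2 .$$ Then there exists an $\mathbf H$-valued random vector $Z=(Z_1,Z_2,\dots)$ with $\mathbf E\,Z=0$, with uncorrelated coordinates and $\mathbf E\,Z_m^2=\sigma_m^2$ for all $m$, such that $\mathbf E\,\|Z\|^\gamma<\infty$ for all $\gamma\geqslant0$, and such that for all $\gamma\geqslant 0$ and for any construction $(X_1,\dots,X_n;Y_1,\dots,Y_n)$ for $Z$ and $n$, $$\mathbf E\,\bigl(\Delta_n(X,Y)\bigr)^\gamma\geqslant c(\gamma)\Bigl(\mathbf E\,\bigl(\Delta_n(X^{(k)},Y^{(k)})\bigr)^\gamma+(n\,B_k^2)^{\gamma/2}\Bigr),$$ where the first term in the brackets on the right-hand side is taken to be zero if $k=0$.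
   Context: $\mathbf H$ is the separable Hilbert space of real sequences $x=(x_1,x_2,\dots)$ with $\|x\|^2=\sum_m x_m^2<\infty$; $\|\cdot\|$ also denotes the Euclidean norm on $\mathbf R^k$. For $x\in\mathbf H$ and $k\geqslant1$, $x^{(k)}=(x_1,\dots,x_k)\in\mathbf R^k$. A construction for $Z$ and $n$ consists of a probability space and, defined on it, $\mathbf H$-valued random vectors $X_1,\dots,X_n,Y_1,\dots,Y_n$ such that $X_1,\dots,X_n$ are independent, each with the distribution of $Z$, and $Y_1,\dots,Y_n$ are independent Gaussian vectors with $\mathbf E\,Y_j=0$ and $\operatorname{cov} Y_j=\operatorname{cov} Z$ for all $j$ (no independence between the $X$'s and the $Y$'s is required). Put $$\Delta_n(X,Y)=\max_{1\leqslant s\leqslant n}\Bigl\|\sum_{j=1}^sX_j-\sum_{j=1}^sY_j\Bigr\|,\qquad \Delta_n(X^{(k)},Y^{(k)})=\max_{1\leqslant s\leqslant n}\Bigl\|\sum_{j=1}^sX_j^{(k)}-\sum_{j=1}^sY_j^{(k)}\Bigr\|.$$ For $\gamma=0$ the convention $0^0=1$ is used. *)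

(* Defs.v *)
From HB Require Import structures.
From mathcomp Require Import all_boot all_order all_algebra.
From mathcomp Require Import all_classical all_reals all_analysis.
From mathcomp Require Import ring lra.
Import Order.TTheory GRing.Theory Num.Theory.
Import numFieldNormedType.Exports.

Set Implicit Arguments.
Unset Strict Implicit.
Unset Printing Implicit Defensive.

Local Open Scope classical_set_scope.
Local Open Scope ring_scope.

(* Coordinates are numbered from 0: the coordinate written x_m (m >= 1) in
   1-based notation is [x m.-1]. *)
Definition square_summable {R : realType} : {pred nat -> R} :=
  [pred x : nat -> R | `[< cvgn (series (fun m => x m ^+ 2)) >]].

Record l2 (R : realType) := L2 {
  l2_seq :> nat -> R;
  _ : l2_seq \in square_summable }.

HB.instance Definition _ (R : realType) := [isSub for @l2_seq R].
HB.instance Definition _ (R : realType) := [Choice of l2 R by <:].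

Section l2_normed.
Variable R : realType.
Implicit Types (u v : nat -> R) (x y : l2 R).

Let sq u : R^nat := fun m => u m ^+ 2.

Lemma square_summableP u : reflect (cvgn (series (sq u))) (u \in square_summable).
Proof. exact: asboolP. Qed.

Lemma square_summable_submod_closed : submod_closed (@square_summable R).
Proof.
split.
  apply/square_summableP; rewrite (_ : series _ = cst 0); first exact: is_cvg_cst.
  by apply/funext => n; rewrite /series/= big1// => i _; rewrite /sq expr0n.
move=> a u v /square_summableP cu /square_summableP cv.
apply/square_summableP.
apply: (@series_le_cvg _ _ ((2 * a ^+ 2) *: sq u + 2 *: sq v)).
- by move=> n; rewrite /sq sqr_ge0.
- move=> n; change (0 <= 2 * a ^+ 2 * (u n ^+ 2) + 2 * v n ^+ 2).
  have := sqr_ge0 (a * u n); have := sqr_ge0 (v n); nra.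
- move=> n; rewrite /sq; change ((a * u n + v n) ^+ 2 <=
    2 * a ^+ 2 * (u n ^+ 2) + 2 * v n ^+ 2).
  have := sqr_ge0 (a * u n - v n); nra.
- by apply: is_cvg_seriesD; apply: is_cvg_seriesZ.
Qed.

HB.instance Definition _ :=
  GRing.isSubmodClosed.Build _ _ (@square_summable R) square_summable_submod_closed.
HB.instance Definition _ := [SubChoice_isSubLmodule of l2 R by <:].

Definition l2_norm x : R := Num.sqrt (limn (series (fun m => x m ^+ 2))).

Let cvg_sq x : cvgn (series (sq x)).
Proof. by apply/square_summableP; exact: (valP x). Qed.

Let limsq_ge0 x : 0 <= limn (series (sq x)).
Proof.
apply: limr_ge; first exact: cvg_sq.
by apply: nearW => n; apply: sumr_ge0 => i _; exact: sqr_ge0.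
Qed.

Let l2_norm_sqr x : l2_norm x ^+ 2 = limn (series (sq x)).
Proof. by rewrite sqr_sqrtr// limsq_ge0. Qed.

Lemma l2_norm_eq0 x : l2_norm x = 0 -> x = 0.
Proof.
move=> x0; apply: val_inj; apply/funext => m /=.
have l0 : limn (series (sq x)) = 0 by rewrite -l2_norm_sqr x0 expr0n.
have nd : nondecreasing_seq (series (sq x)).
  apply/nondecreasing_seqP => n.
  by rewrite /series/= big_nat_recr//= lerDl sqr_ge0.
have := nondecreasing_cvgn_le nd (@cvg_sq x) m.+1.
rewrite l0 /series/= big_nat_recr//= => h.
have s0 : 0 <= \sum_(0 <= i < m) sq x i by apply: sumr_ge0 => i _; exact: sqr_ge0.
have : sq x m <= 0 by apply: le_trans h; rewrite lerDr.
by rewrite /sq exprn_even_le0//= => /eqP.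
Qed.

Lemma l2_normZ (a : R) x : l2_norm (a *: x) = `|a| * l2_norm x.
Proof.
rewrite -sqrtr_sqr -sqrtrM ?sqr_ge0//; congr (Num.sqrt _).
rewrite -[RHS]/((a ^+ 2) *: limn (series (sq x))) -lim_seriesZ; last exact: cvg_sq.
by congr (limn (series _)); apply/funext => m; rewrite /sq -[RHS]exprMn.
Qed.

Lemma l2_normD x y : l2_norm (x + y) <= l2_norm x + l2_norm y.
Proof.
have [/l2_norm_eq0 ->|x0] := eqVneq (l2_norm x) 0.
  by rewrite add0r lerDr sqrtr_ge0.
have [/l2_norm_eq0 ->|y0] := eqVneq (l2_norm y) 0.
  by rewrite addr0 lerDl sqrtr_ge0.
have A0 : 0 < l2_norm x by rewrite lt_def x0 sqrtr_ge0.
have B0 : 0 < l2_norm y by rewrite lt_def y0 sqrtr_ge0.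
set A := l2_norm x in A0 x0 *; set B := l2_norm y in B0 y0 *.
rewrite -(@ler_sqr _ (l2_norm (x + y))) ?nnegrE ?addr_ge0 ?sqrtr_ge0//.
rewrite l2_norm_sqr.
have -> : (A + B) ^+ 2 =
    limn (series ((1 + B / A) *: sq x + (1 + A / B) *: sq y)).
  have cZ (a : R) (z : l2 R) : cvgn (series (a *: sq z)).
    by apply: is_cvg_seriesZ; exact: cvg_sq.
  rewrite (lim_seriesD (@cZ _ x) (@cZ _ y)).
  rewrite (lim_seriesZ _ (@cvg_sq x)) (lim_seriesZ _ (@cvg_sq y)).
  rewrite -!l2_norm_sqr -/A -/B.
  change ((A + B) ^+ 2 = (1 + B / A) * A ^+ 2 + (1 + A / B) * B ^+ 2).
  by field; rewrite x0 y0.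
apply: lim_series_le; first exact: cvg_sq.
  by apply: is_cvg_seriesD; apply: is_cvg_seriesZ; exact: cvg_sq.
move=> m; rewrite /sq; change ((x m + y m) ^+ 2 <=
  (1 + B / A) * x m ^+ 2 + (1 + A / B) * y m ^+ 2).
rewrite -subr_ge0 (_ : _ - _ = (B * x m - A * y m) ^+ 2 / (A * B)).
  by rewrite divr_ge0 ?sqr_ge0// mulr_ge0// ltW.
by field; rewrite x0 y0.
Qed.

HB.instance Definition _ :=
  Lmodule_isNormed.Build R (l2 R) l2_normD l2_normZ l2_norm_eq0.

End l2_normed.

(* Borel sigma-algebra of the norm topology *)
HB.instance Definition _ (R : realType) :=
  Measurable.copy (l2 R) (g_sigma_algebraType (@open (l2 R))).

Section definitions.
Variable R : realType.

Definition l2_dot (x y : l2 R) : R := limn (series (fun m => x m * y m)).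

(* first k coordinates, as a vector of R^k *)
Definition first_coords (k : nat) (x : l2 R) : 'rV[R]_k := \row_(i < k) x i.

(* the library norm on ['rV_k] is the sup norm *)
Definition eucl_norm (k : nat) (v : 'rV[R]_k) : R :=
  Num.sqrt (\sum_(i < k) v 0 i ^+ 2).

(* [N] is the norm of [V]; the sums range over j = 0, ..., s, i.e. over the
   first s+1 terms, for s = 0, ..., n-1; the base value 0 is harmless since
   norms are nonnegative and n > 0 *)
Definition Delta (V : zmodType) (N : V -> R) (n : nat) (x y : 'I_n -> V) : R :=
  \big[Num.max/0]_(s < n)
    N (\sum_(j < n | (j <= s)%N) x j - \sum_(j < n | (j <= s)%N) y j).

Section random_vectors.
Context d (T : measurableType d) (P : probability T R).

(* taking some [A i := setT] yields the product rule for all subfamilies *)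
Definition independent_RVs d' (E : measurableType d') (n : nat)
    (X : 'I_n -> {RV P >-> E}) : Prop :=
  forall A : 'I_n -> set E, (forall i, measurable (A i)) ->
    P (\bigcap_(i in [set: 'I_n]) X i @^-1` A i) =
    (\prod_(i < n) P (X i @^-1` A i))%E.

(* the library's [normal_prob m s] (standard deviation s) is not the point mass
   when s = 0 *)
Definition gaussian_law (m s : R) : set R -> \bar R :=
  if s == 0 then \d_m else normal_prob m s.

Definition gaussian_real (f : T -> R) : Prop :=
  measurable_fun setT f /\
  exists m s : R, forall A : set R, measurable A ->
    P (f @^-1` A) = gaussian_law m s A.

Definition gaussian_vector (X : {RV P >-> l2 R}) : Prop :=
  forall h : l2 R, gaussian_real (fun w => l2_dot (X w) h).

(* mean in the weak sense; [\int] of a function whose positive and negative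
   parts both have infinite integral is -oo, so equality with a real entails
   integrability *)
Definition has_mean (X : {RV P >-> l2 R}) (m : l2 R) : Prop :=
  forall h : l2 R, ('E_P[fun w => l2_dot (X w) h] = (l2_dot m h)%:E)%E.

(* covariance operator, as a bilinear form *)
Definition cov_form (X : {RV P >-> l2 R}) (g h : l2 R) : \bar R :=
  covariance P (fun w => l2_dot (X w) g) (fun w => l2_dot (X w) h).

End random_vectors.

Definition same_distribution d1 (T1 : measurableType d1) (P1 : probability T1 R)
    d2 (T2 : measurableType d2) (P2 : probability T2 R)
    d' (E : measurableType d') (X1 : {RV P1 >-> E}) (X2 : {RV P2 >-> E}) : Prop :=
  forall A : set E, measurable A -> distribution P1 X1 A = distribution P2 X2 A.

Definition is_construction d0 (T0 : measurableType d0) (P0 : probability T0 R)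
    (Z : {RV P0 >-> l2 R}) (n : nat)
    d (T : measurableType d) (P : probability T R)
    (X Y : 'I_n -> {RV P >-> l2 R}) : Prop :=
  [/\ independent_RVs X,
      forall j, same_distribution (X j) Z,
      independent_RVs Y,
      forall j, gaussian_vector (Y j) &
      forall j, has_mean (Y j) 0 /\ cov_form (Y j) = cov_form Z].

End definitions.

(* Main.v *)
Require Import Defs.
From HB Require Import structures.
From mathcomp Require Import all_boot all_order all_algebra.
From mathcomp Require Import all_classical all_reals all_analysis.
From mathcomp Require Import measurable_realfun ring lra.
Import Order.TTheory GRing.Theory Num.Theory.
Import numFieldNormedType.Exports.
Local Open Scope classical_set_scope.
Local Open Scope ring_scope.

(* Take Z with values 0 and +a e_m, -a e_m (e_m the unit vectors), each of the
   last two with probability sigma_m^2 / (2 a^2), where a is so large that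
   n sigma_m^2 is a small fraction of a^2 for all m. Every coordinate of a sum
   of X's lies in the lattice aZ. The m-th coordinate t of the sum of the Y's
   has variance v_m = n sigma_m^2 and fourth moment at most C v_m^2, so it is
   mostly much closer to 0 than to the other points of aZ; quantitatively, its
   squared distance to aZ is at least t^2 - 4 t^4 / a^2, with expectation at
   least v_m / 2. Summing over finitely many m > k with v_m adding up to V, where
   V is at least n B_k^2 / 2, a Paley-Zygmund argument bounds the squared
   deviation from below by V / 4 with probability at least 1 / (16 C). Only
   moments of the coordinates are used, so no independence between different
   coordinates is needed. *)

(** * Integrals of real functions under a probability measure *)

Section real_integrals.
Context d (T : measurableType d) (R : realType) (P : probability T R).
Implicit Types f g : T -> R.

Lemma ge0_integrable_le f (a : R) : measurable_fun setT f ->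
  (forall x, 0 <= f x) -> (\int[P]_x (f x)%:E <= a%:E)%E ->
  P.-integrable setT (EFin \o f) /\ \int[P]_x f x <= a.
Proof.
move=> mf f0 fa; have If : P.-integrable setT (EFin \o f).
  apply/integrableP; split; first exact/measurable_EFinP.
  under eq_integral do rewrite /= ger0_norm//.
  exact: le_lt_trans fa (ltry _).
split => //; rewrite -lee_fin /Rintegral fineK//.
exact: (integrable_fin_num measurableT).
Qed.

Lemma EFin_Rintegral f : P.-integrable setT (EFin \o f) ->
  (\int[P]_x (f x)%:E = (\int[P]_x f x)%:E)%E.
Proof. by move=> If; rewrite /Rintegral fineK//; exact: (integrable_fin_num measurableT). Qed.

Lemma le_norm_integrable f g : measurable_fun setT f ->
  P.-integrable setT (EFin \o g) -> (forall x, `|f x| <= g x) ->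
  P.-integrable setT (EFin \o f).
Proof.
move=> mf Ig fg; apply: (le_integrable measurableT _ _ Ig).
  exact/measurable_EFinP.
by move=> x _ /=; rewrite lee_fin (le_trans (fg x))// ler_norm.
Qed.

Lemma integrable_cstr (a : R) : P.-integrable setT (EFin \o cst a).
Proof.
exact: finite_measure_integrable_cst.
Qed.

Lemma integrable_EFinZ (a : R) f : P.-integrable setT (EFin \o f) ->
  P.-integrable setT (EFin \o (fun x => a * f x)).
Proof. by move=> If; exact: (integrableZl measurableT a If). Qed.

Lemma integrable_EFinD f g : P.-integrable setT (EFin \o f) ->
  P.-integrable setT (EFin \o g) ->
  P.-integrable setT (EFin \o (fun x => f x + g x)).
Proof. by move=> If Ig; exact: (integrableD measurableT If Ig). Qed.

Lemma Rintegral_prob_cst (a : R) : \int[P]_x a = a.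
Proof.
by rewrite (Rintegral_cst P measurableT) /= probability_setT mulr1.
Qed.

Lemma integrable_powers f : measurable_fun setT f ->
  P.-integrable setT (EFin \o (fun w => f w ^+ 4)) ->
  forall k, (k <= 4)%N -> P.-integrable setT (EFin \o (fun w => f w ^+ k)).
Proof.
move=> mf I k k4; apply: (le_norm_integrable _ (fun w => 1 + f w ^+ 4)).
- exact: measurable_funX.
- by apply: integrable_EFinD => //; exact: integrable_cstr.
- move=> w; rewrite normrX (_ : f w ^+ 4 = `|f w| ^+ 4); last first.
    by rewrite -normrX ger0_norm// exprn_even_ge0.
  have [z1|z1] := lerP `|f w| 1.
    by rewrite (le_trans (exprn_ile1 _ _ z1))// lerDl exprn_ge0.
  by rewrite (le_trans (ler_weXn2l (ltW z1) k4))// lerDr.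
Qed.

End real_integrals.

(** * Moments of the normal law *)

Section gaussian_moments.
Context {R : realType}.
Implicit Types (m s : R).
Notation mu := (@lebesgue_measure R).

(** Change of variables: the Radon-Nikodym derivative of [normal_prob] equals [normal_pdf] almost
    everywhere, because both have the same integral over every measurable set. *)
Lemma ge0_integral_normal_prob m s (g : R -> \bar R) :
  measurable_fun setT g -> (forall x, 0 <= g x)%E ->
  (\int[normal_prob m s]_x g x = \int[mu]_x (g x * (normal_pdf m s x)%:E))%E.
Proof.
move=> mg g0; have dom := normal_prob_dominates m s.
rewrite -(Radon_Nikodym_SigmaFinite.change_of_variables dom)//.
have mf := measurable_int _ (Radon_Nikodym_SigmaFinite.f_integrable dom).
have mp : measurable_fun setT (fun x : R => (normal_pdf m s x)%:E).
  by apply/measurable_EFinP; exact: measurable_normal_pdf.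
apply: ge0_ae_eq_integral => //.
- exact: emeasurable_funM.
- exact: emeasurable_funM.
- by move=> x _; rewrite mule_ge0// Radon_Nikodym_SigmaFinite.f_ge0.
- by move=> x _; rewrite mule_ge0// lee_fin normal_pdf_ge0.
have [N [mN N0 fN]] : ae_eq mu setT (Radon_Nikodym_SigmaFinite.f (normal_prob m s) mu)
    (fun x : R => (normal_pdf m s x)%:E).
  apply: integral_ae_eq => //; first exact: Radon_Nikodym_SigmaFinite.f_integrable.
  by move=> E _ mE; rewrite -Radon_Nikodym_SigmaFinite.f_integral.
exists N; split => // x /= h; apply: fN => /= h2; apply: h => _.
by rewrite h2.
Qed.

(* Absorbing the factor (x - m)^4 doubles the standard deviation: the integrand is
   at most 32 s^4 times the density with parameters m and 2 s. *)
Lemma normal_fourth_central_moment_le m s : s != 0 ->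
  (\int[normal_prob m s]_x ((x - m) ^+ 4)%:E <= (32 * s ^+ 4)%:E)%E.
Proof.
move=> s0; have s20 : 2 * s != 0 by rewrite mulf_neq0.
have mx : measurable_fun setT (fun x : R => ((x - m) ^+ 4)%:E).
  by apply/measurable_EFinP; apply: measurable_funX; exact: measurable_funB.
rewrite ge0_integral_normal_prob//; last first.
  by move=> x; rewrite lee_fin exprn_even_ge0.
have -> : (32 * s ^+ 4)%:E =
    (\int[mu]_x ((32 * s ^+ 4)%:E * (normal_pdf m (2 * s) x)%:E))%E.
  rewrite integralZl//; last exact: integrable_normal_pdf.
  by rewrite integral_normal_pdf mule1.
have mp t : measurable_fun setT (fun x : R => (normal_pdf m t x)%:E).
  by apply/measurable_EFinP; exact: measurable_normal_pdf.
apply: ge0_le_integral => //.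
- by move=> x _; rewrite mule_ge0// lee_fin ?normal_pdf_ge0// exprn_even_ge0.
- by apply: emeasurable_funM; [exact: mx|exact: mp].
- by apply: emeasurable_funM; [exact: measurable_cst|exact: mp].
move=> x _; rewrite -!EFinM lee_fin !normal_pdfE//.
have peak2 : normal_peak (2 * s) = normal_peak s / 2.
  rewrite /normal_peak (_ : (2 * s) ^+ 2 * pi *+ 2 = 2 ^+ 2 * (s ^+ 2 * pi *+ 2)); last by ring.
  by rewrite sqrtrM ?sqr_ge0// sqrtr_sqr ger0_norm// invfM mulrC.
rewrite peak2 /normal_fun.
set t := (x - m) ^+ 2 / (s ^+ 2 *+ 2).
have ss : s ^+ 2 *+ 2 != 0 by rewrite mulrn_eq0/= sqrf_eq0.
have -> : - (x - m) ^+ 2 / (s ^+ 2 *+ 2) = - t by rewrite mulNr.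
have -> : - (x - m) ^+ 2 / ((2 * s) ^+ 2 *+ 2) = - t + 3 * t / 4.
  by rewrite /t; field.
have -> : (x - m) ^+ 4 = 4 * s ^+ 4 * t ^+ 2 by rewrite /t; field.
have t0 : 0 <= t by rewrite divr_ge0 ?sqr_ge0// mulrn_wge0// sqr_ge0.
(* In terms of [t] the claim becomes [t ^+ 2 <= 4 * expR (3 * t / 4)]. The bound exp(y) >= 1 + y^2 /
   2 at y = 3 t / 4 suffices, as 32 / 9 <= 4. *)
have := @expR_ge1Dxn R (3 * t / 4) 1 _.
rewrite expRD => /(_ ltac:(lra)) h.
have h2 : t ^+ 2 <= 4 * expR (3 * t / 4).
  move: h; rewrite (_ : 2`! = 2)// => h.
  have := sqr_ge0 t; nra.
have A0 : 0 <= 4 * s ^+ 4 * normal_peak s * expR (- t).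
  rewrite mulr_ge0 ?expR_ge0// mulr_ge0 ?normal_peak_ge0//.
  by rewrite mulr_ge0// exprn_even_ge0.
have := ler_wpM2l A0 h2; lra.
Qed.

(* The density is at most 1 / (2 |s|), so that half of the mass lies outside
   [-|s|/2, |s|/2]. *)
Lemma normal_second_moment_ge m s : s != 0 ->
  ((s ^+ 2 / 8)%:E <= \int[normal_prob m s]_x (x ^+ 2)%:E)%E.
Proof.
move=> s0; pose I := `[- `|s| / 2, `|s| / 2]%classic : set R.
have mI : measurable I by exact: measurable_itv.
have as0 : 0 < `|s| by rewrite normr_gt0.
have peak : normal_peak s <= (2 * `|s|)^-1.
  have s2 : 0 < s ^+ 2 by rewrite exprn_even_gt0.
  have sp : 0 < s ^+ 2 * pi *+ 2 by rewrite pmulrn_lgt0// mulr_gt0// pi_gt0.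
  rewrite lef_pV2 ?posrE ?sqrtr_gt0//; last by rewrite mulr_gt0.
  rewrite -[leLHS]ger0_norm; last by rewrite mulr_ge0// ltW.
  rewrite -sqrtr_sqr ler_sqrt ?sqr_ge0//; last first.
    by rewrite mulrn_wge0// mulr_ge0 ?sqr_ge0// pi_ge0.
  rewrite exprMn real_normK ?num_real//.
  have := @pi_ge2 R; have := sqr_ge0 s; nra.
have nuI : (normal_prob m s I <= (1 / 2)%:E)%E.
  rewrite /normal_prob.
  apply: (@le_trans _ _ (\int[mu]_(x in I) (cst (2 * `|s|)^-1%:E x)))%E.
    apply: ge0_le_integral => //.
    - by move=> x _; rewrite lee_fin normal_pdf_ge0.
    - by apply/measurable_EFinP; apply: measurable_funTS; exact: measurable_normal_pdf.
    - by move=> x _; rewrite lee_fin (le_trans _ peak)// normal_pdf_ub.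
  rewrite integral_cst//= lebesgue_measure_itv/= lte_fin ifT; last lra.
  rewrite -EFinD -EFinM lee_fin.
  rewrite (_ : _ * _ = 1 / 2)//; field; lra.
have nuC : ((1 / 2)%:E <= normal_prob m s (~` I))%E.
  rewrite probability_setC//.
  have : normal_prob m s I \is a fin_num by exact: fin_num_measure.
  change (normal_prob m s I \is a fin_num -> ((1 / 2)%:E <= 1 - normal_prob m s I)%E).
  move=> /fineK nuIE; move: nuI; rewrite -nuIE -EFinB !lee_fin; lra.
have mx : measurable_fun setT (fun x : R => (x ^+ 2)%:E).
  by apply/measurable_EFinP; exact: measurable_funX.
apply: (@le_trans _ _ (\int[normal_prob m s]_(x in ~` I) (cst (s ^+ 2 / 4)%:E x))%E).
  rewrite integral_cst//=; last exact: measurableC.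
  apply: (@le_trans _ _ ((s ^+ 2 / 4)%:E * (1 / 2)%:E)%E).
    by rewrite -EFinM lee_fin; lra.
  by rewrite lee_wpmul2l// lee_fin divr_ge0// sqr_ge0.
apply: (@le_trans _ _ (\int[normal_prob m s]_(x in ~` I) (x ^+ 2)%:E)%E); last first.
  apply: ge0_subset_integral => //; first exact: measurableC.
  by move=> x _; rewrite lee_fin sqr_ge0.
apply: ge0_le_integral => //; first exact: measurableC.
- by move=> x _; rewrite lee_fin divr_ge0// sqr_ge0.
- exact: measurable_funTS.
move=> x; rewrite /I/= in_itv/= => /negP; rewrite negb_and -!ltNge => h.
rewrite lee_fin -(real_normK (num_real s)); case/orP: h => h; nra.
Qed.

(** The raw second moment [v] controls both parameters: [s ^+ 2 <= 8 * v] by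
    [normal_second_moment_ge], and then the mean is bounded through the fourth central moment. What
    remains is (m + u)^4 <= 8 m^4 + 8 u^4. *)
Lemma gaussian_fourth_moment_le : exists2 C : R, 1 <= C &
  forall d (T : measurableType d) (P : probability T R) (f : T -> R) (v : R),
    gaussian_real P f -> (\int[P]_w (f w ^+ 2)%:E = v%:E)%E ->
    (\int[P]_w (f w ^+ 4)%:E <= (C * v ^+ 2)%:E)%E.
Proof.
(* Collects [m ^+ 2 <= 266 * v], [s ^+ 4 <= 64 * v ^+ 2] and the factor 8 * 32 = 256 in front of
   s^4. *)
exists (8 * 266 ^+ 2 + 256 * 64); first lra.
move=> d T P f v [mf [m [s law]]] fv.
have mX k : measurable_fun setT (fun x : R => (x ^+ k)%:E).
  by apply/measurable_EFinP; exact: measurable_funX.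
have mf' : measurable_fun (setT : set T) (f : T -> measurableTypeR R) by exact: mf.
pose g : {mfun T >-> measurableTypeR R} :=
  HB.pack (f : T -> measurableTypeR R) (isMeasurableFun.Build _ _ T (measurableTypeR R) f mf').
have push k : ~~ odd k -> (\int[P]_w (f w ^+ k)%:E = \int[distribution P g]_x (x ^+ k)%:E)%E.
  move=> ek; rewrite ge0_integral_distribution//.
    exact: mX.
  by move=> y; rewrite lee_fin exprn_even_ge0.
(* In the degenerate case the law is a point mass at [m], so that v = m^2 and the fourth moment is
   v^2. *)
move: law; rewrite /gaussian_law; case: eqVneq => [_|s0] law.
  have intE k : (\int[distribution P g]_x (x ^+ k)%:E = (m ^+ k)%:E)%E.
    have -> := @eq_measure_integral _ (measurableTypeR R) R setT
      (\d_(m : measurableTypeR R)) (distribution P g) (fun x => (x ^+ k)%:E)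
      (fun A mA _ => law A mA).
    by rewrite integral_dirac//; [rewrite diracT mul1e|exact: mX].
  move: fv; rewrite !push// !intE => -[<-]; rewrite lee_fin.
  rewrite -exprM; have : 0 <= m ^+ 4 by rewrite exprn_even_ge0.
  by lra.
have intE k : (\int[distribution P g]_x (x ^+ k)%:E =
    \int[normal_prob m s]_x (x ^+ k)%:E)%E.
  have := @eq_measure_integral _ _ _ setT (normal_prob m s) (distribution P g)
    (fun x : R => (x ^+ k)%:E).
  by apply => A mA _; exact: law.
move: fv; rewrite !push// !intE => fv.
have s2 : s ^+ 2 <= 8 * v.
  have := normal_second_moment_ge m s s0; rewrite fv lee_fin; lra.
have s2gt0 : 0 < s ^+ 2 by rewrite exprn_even_gt0.
have m2 : measurable_fun setT (fun x : R => x ^+ 2) by exact: measurable_funX.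
have m4 : measurable_fun setT (fun x : R => x ^+ 4) by exact: measurable_funX.
have mc : measurable_fun setT (fun x : R => (x - m) ^+ 4).
  by apply: measurable_funX; exact: measurable_funB.
pose Q : probability (measurableTypeR R) R := normal_prob m s.
have [I2 E2] : Q.-integrable setT (EFin \o (fun x : R => x ^+ 2)) /\ \int[Q]_x (x ^+ 2) <= v.
  apply: ge0_integrable_le => //; first by move=> x; rewrite sqr_ge0.
  by rewrite fv.
have [Ic Ec] : Q.-integrable setT (EFin \o (fun x : R => (x - m) ^+ 4)) /\
    \int[Q]_x ((x - m) ^+ 4) <= 32 * s ^+ 4.
  apply: ge0_integrable_le => //; first by move=> x; rewrite exprn_even_ge0.
  exact: normal_fourth_central_moment_le.
(* With u = x - m one has m^2 <= 2 x^2 + 2 u^2, and 2 u^2 <= s^2 + u^4 / s^2 by AM-GM. Integration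
   gives m^2 <= 2 v + 33 s^2, which is at most 266 v. *)
have mle : m ^+ 2 <= 266 * v.
  have : \int[Q]_x (m ^+ 2) <= \int[Q]_x (2 * x ^+ 2 + (s ^+ 2 + (s ^+ 2)^-1 * (x - m) ^+ 4)).
    apply: le_Rintegral => //; first exact: integrable_cstr.
      by apply: integrable_EFinD; [exact: integrable_EFinZ|
        apply: integrable_EFinD; [exact: integrable_cstr|exact: integrable_EFinZ]].
    move=> x _; set u := x - m; rewrite (_ : x = m + u); last by rewrite /u; ring.
    pose q := u ^+ 2 / s ^+ 2.
    have uq : u ^+ 2 = q * s ^+ 2 by rewrite /q; field.
    rewrite (_ : _^-1 * _ = q ^+ 2 * s ^+ 2); last by rewrite /q; field.
    have := mulr_ge0 (sqr_ge0 (q - 1)) (sqr_ge0 s).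
    have := sqr_ge0 (m + 2 * u); nra.
  rewrite Rintegral_prob_cst RintegralD//; [|exact: integrable_EFinZ|
    by apply: integrable_EFinD; [exact: integrable_cstr|exact: integrable_EFinZ]].
  rewrite RintegralD//; [|exact: integrable_cstr|exact: integrable_EFinZ].
  rewrite Rintegral_prob_cst !RintegralZl//.
  have : (s ^+ 2)^-1 * \int[Q]_x ((x - m) ^+ 4) <= 32 * s ^+ 2.
    by rewrite mulrC ler_pdivrMr// (le_trans Ec)// (_ : s ^+ 4 = s ^+ 2 * s ^+ 2); [lra|ring].
  lra.
apply: (@le_trans _ _ (\int[Q]_x (8 * m ^+ 4 + 8 * (x - m) ^+ 4)%:E)%E).
  apply: ge0_le_integral => //.
  - by move=> x _; rewrite lee_fin exprn_even_ge0.
  - exact: mX.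
  - apply: (measurable_int Q).
    by apply: integrable_EFinD; [exact: integrable_cstr|exact: integrable_EFinZ].
  - move=> x _; rewrite lee_fin; set u := x - m.
    rewrite (_ : x = m + u); last by rewrite /u; ring.
    rewrite (_ : (m + u) ^+ 4 = ((m + u) ^+ 2) ^+ 2); last by ring.
    have h1 : (m + u) ^+ 2 <= 2 * (m ^+ 2 + u ^+ 2) by have := sqr_ge0 (m - u); nra.
    have := ler_pM (sqr_ge0 (m + u)) (sqr_ge0 (m + u)) h1 h1.
    have := sqr_ge0 (m ^+ 2 - u ^+ 2); nra.
rewrite EFin_Rintegral; last first.
  by apply: integrable_EFinD; [exact: integrable_cstr|exact: integrable_EFinZ].
rewrite RintegralD//; [|exact: integrable_cstr|exact: integrable_EFinZ].
rewrite Rintegral_prob_cst RintegralZl// lee_fin.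
have m4le : m ^+ 4 <= 266 ^+ 2 * v ^+ 2.
  rewrite (_ : m ^+ 4 = m ^+ 2 * m ^+ 2); last by ring.
  have := ler_pM (sqr_ge0 m) (sqr_ge0 m) mle mle; lra.
have s4le : s ^+ 4 <= 64 * v ^+ 2.
  rewrite (_ : s ^+ 4 = s ^+ 2 * s ^+ 2); last by ring.
  have := ler_pM (sqr_ge0 s) (sqr_ge0 s) s2 s2; lra.
lra.
Qed.
End gaussian_moments.

(** * Independence: joint laws and expectations of products *)

Section independence.
Context d (T : measurableType d) (R : realType) (P : probability T R).

(** As functions of [C], both sides are measures on the plane that agree on rectangles, so both are
    the product of [P D] times the law of [X] with the law of [Y]. The extra event [D] lets the pair
    stay independent of later variables in the induction on partial sums. *)
Lemma product_law_event (X Y : {RV P >-> R}) (D : set T) : measurable D ->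
  (forall A B, measurable A -> measurable B ->
    P (X @^-1` A `&` Y @^-1` B `&` D) =
    (P (X @^-1` A) * P (Y @^-1` B) * P D)%E) ->
  forall C : set (R * R), measurable C ->
    P ((fun w => (X w, Y w)) @^-1` C `&` D) =
    ((distribution P X \x distribution P Y) C * P D)%E.
Proof.
move=> mD ind C mC.
have mXY : measurable_fun setT (fun w => (X w, Y w)) by exact/measurable_fun_pair.
pose XY : {mfun T >-> (R * R)%type} :=
  HB.pack (fun w => (X w, Y w)) (isMeasurableFun.Build _ _ T (R * R)%type _ mXY).
have PDfin : P D \is a fin_num by exact: fin_num_measure.
have PDp : 0 <= fine (P D) by exact: fine_ge0.
pose p : {nonneg R} := NngNum PDp.
pose m1 : {finite_measure set R -> \bar R} := mscale p (distribution P X).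
pose m2 : {measure set (R * R) -> \bar R} :=
  mscale p (distribution P X \x distribution P Y)%E.
pose m3 : {measure set (R * R) -> \bar R} :=
  pushforward (mrestr P mD) XY.
transitivity ((m1 \x distribution P Y)%E C).
  rewrite (@product_measure_unique _ _ _ _ _ m1 (distribution P Y) (m3 mXY))//.
  move=> A B mA mB; rewrite /m3 /m1 /= /pushforward /mrestr /mscale /=.
  by rewrite -[LHS]/(P (X @^-1` A `&` Y @^-1` B `&` D)) ind// muleC muleA fineK.
rewrite (@product_measure_unique _ _ _ _ _ m1 (distribution P Y) m2)//.
  by rewrite /m2 /= /mscale /= fineK// muleC.
move=> A B mA mB; change (p%:num%:E * (distribution P X \x distribution P Y) (A `*` B) =
  p%:num%:E * distribution P X A * distribution P Y B)%E.
by rewrite product_measure1E// muleA.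
Qed.

(** By [product_law_event] with [D := setT] the joint law is a product. Tonelli for the absolute
    value gives integrability, and Fubini then factors the integral. *)
Lemma independent_pair_expectation (X Y : {RV P >-> R}) (f g : R -> R) :
  (forall A B, measurable A -> measurable B ->
    P (X @^-1` A `&` Y @^-1` B) = (P (X @^-1` A) * P (Y @^-1` B))%E) ->
  measurable_fun setT f -> measurable_fun setT g ->
  P.-integrable setT (EFin \o (f \o X)) ->
  P.-integrable setT (EFin \o (g \o Y)) ->
  P.-integrable setT (EFin \o (fun w => f (X w) * g (Y w))) /\
  \int[P]_w (f (X w) * g (Y w)) = \int[P]_w f (X w) * \int[P]_w g (Y w).
Proof.
move=> ind mf mg If Ig.
have mXY : measurable_fun setT (fun w => (X w, Y w)) by exact/measurable_fun_pair.
pose XY : {mfun T >-> (R * R)%type} :=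
  HB.pack (fun w => (X w, Y w)) (isMeasurableFun.Build _ _ T (R * R)%type _ mXY).
pose dX : probability R R := distribution P X.
pose dY : probability R R := distribution P Y.
pose law : {measure set (R * R) -> \bar R} := distribution P XY.
have lawE C : measurable C -> law C = (dX \x dY)%E C.
  move=> mC; have := @product_law_event X Y setT measurableT _ C mC.
  rewrite setIT probability_setT mule1; apply => A B mA mB.
  by rewrite setIT mule1 ind.
pose h (z : R * R) : \bar R := (f z.1 * g z.2)%:E.
have mh : measurable_fun setT h.
  apply/measurable_EFinP; apply: measurable_funM; apply: measurableT_comp => //.
have IfX : dX.-integrable setT (EFin \o f).
  by apply: integrable_pushforward => //; exact/measurable_EFinP.
have IgY : dY.-integrable setT (EFin \o g).
  by apply: integrable_pushforward => //; exact/measurable_EFinP.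
have int_norm (D : probability R R) k : D.-integrable setT (EFin \o k) ->
    (\int[D]_x `|(k x)%:E| < +oo)%E by move/integrableP => [].
have Ih : (dX \x dY)%E.-integrable setT h.
  apply/integrableP; split => //.
  have mah : measurable_fun setT (abse \o h) by exact: measurableT_comp.
  rewrite (@fubini_tonelli1 _ _ _ _ _ dX dY (abse \o h) mah); last first.
    by move=> z; exact: abse_ge0.
  rewrite /fubini_F/=.
  under eq_integral => x _.
    under eq_integral => y _ do rewrite normrM EFinM.
    rewrite ge0_integralZl//; last first.
      by apply/measurable_EFinP; exact: measurableT_comp.
    over.
  rewrite ge0_integralZr//; last 2 first.
    by apply/measurable_EFinP; exact: measurableT_comp.
    by apply: integral_ge0.
  rewrite lte_mul_pinfty//; [exact: integral_ge0| |exact: int_norm].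
  by rewrite ge0_fin_numE ?integral_ge0//; exact: int_norm.
have Ilaw : law.-integrable setT h.
  apply/integrableP; split => //.
  rewrite (eq_measure_integral (dX \x dY)%E); last by move=> A mA _; exact: lawE.
  by case/integrableP: Ih.
have IP : P.-integrable setT (EFin \o (fun w => f (X w) * g (Y w))).
  apply/integrableP; split.
    apply/measurable_EFinP; apply: measurable_funM; exact: measurableT_comp.
  case/integrableP : Ilaw => _; rewrite ge0_integral_pushforward//.
  exact: measurableT_comp.
split => //; apply: EFin_inj.
rewrite EFinM -!EFin_Rintegral//.
transitivity (\int[law]_z h z)%E.
  by rewrite integral_pushforward.
rewrite (eq_measure_integral (dX \x dY)%E); last by move=> A mA _; exact: lawE.
rewrite -integral12_prod_meas1//.
transitivity (\int[dX]_x ((f x)%:E * \int[dY]_y (g y)%:E))%E.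
  apply: eq_integral => x _; rewrite /fubini_F /h/=.
  by under eq_integral => y _ do rewrite EFinM; rewrite integralZl.
have -> : (\int[dY]_y (g y)%:E = \int[P]_w (g (Y w))%:E)%E.
  by rewrite integral_pushforward//; exact/measurable_EFinP.
rewrite EFin_Rintegral// integralZr//; congr (_ * _)%E.
by rewrite integral_pushforward//; exact/measurable_EFinP.
Qed.

(** * Partial sums of independent real variables and their fourth moments *)

Section partial_sums.
Variables (X : nat -> {RV P >-> R}) (n : nat).

Let tail (s : nat) (A : nat -> set R) : set T :=
  \bigcap_(i in [set i | (s <= i < n)%N]) X i @^-1` A i.

Definition mutually_independent := forall A, (forall i, measurable (A i)) ->
  P (tail 0 A) = (\prod_(0 <= i < n) P (X i @^-1` A i))%E.

Definition partial_sum (s : nat) (w : T) : R := \sum_(0 <= i < s) X i w.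

Lemma measurable_partial_sum s : measurable_fun setT (partial_sum s).
Proof. exact: measurable_sum. Qed.

HB.instance Definition _ s :=
  isMeasurableFun.Build _ _ _ _ (partial_sum s) (measurable_partial_sum s).

Let measurable_tail s A : (forall i, measurable (A i)) -> measurable (tail s A).
Proof.
move=> mA; apply: bigcap_measurableType => i _.
by rewrite -[X in measurable X]setTI; exact: (measurable_funP (X i)).
Qed.

Let tailS s A : (s < n)%N -> tail s A = X s @^-1` A s `&` tail s.+1 A.
Proof.
move=> sn; apply/seteqP; split => w.
  move=> h; split; first by apply: h => /=; rewrite leqnn.
  by move=> i /= /andP[si i_n]; apply: h; rewrite /= (ltnW si).
move=> [h0 h] i /= /andP[]; rewrite leq_eqVlt => /predU1P[<-//|si i_n].
by apply: h; rewrite /= si.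
Qed.

Let eq_tail s A A' : (forall i, (s <= i < n)%N -> A i = A' i) -> tail s A = tail s A'.
Proof.
by move=> AA'; apply/seteqP; split => w h i /= si; have := h i si; rewrite AA'.
Qed.

Let tailT s : tail s (fun=> setT) = setT.
Proof. by apply/seteqP; split. Qed.

(** Induction on [s], which closes because the statement carries the events of all later variables:
    [X s] is split off from the tail and joined to the sum, while the rest of the tail serves as the
    event [D] of [product_law_event]. *)
Lemma partial_sum_tail (ind : mutually_independent) s A B : (s <= n)%N ->
  (forall i, measurable (A i)) -> measurable B ->
  P (partial_sum s @^-1` B `&` tail s A) =
  (P (partial_sum s @^-1` B) * \prod_(s <= i < n) P (X i @^-1` A i))%E.
Proof.
move=> sn mA; elim: s => [|s IH] in sn A mA B *; move=> mB.
  (* The empty sum is 0, so its event is either everything or nothing. *)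
  rewrite -ind// (_ : _ @^-1` B = [set _ | B 0]); last first.
    by apply/seteqP; split => w; rewrite /partial_sum/= big_nil.
  have [B0|B0] := pselect (B 0).
    rewrite (_ : [set _ | _] = setT); last by apply/seteqP; split.
    by rewrite setTI probability_setT mul1e.
  rewrite (_ : [set _ | _] = set0); last by apply/seteqP; split.
  by rewrite set0I measure0 mul0e.
(* The induction hypothesis with [B'] as the set at index [s]: it separates the sum, [X s] and the
   later variables. *)
have key A' B' C : (forall i, measurable (A' i)) -> measurable B' -> measurable C ->
    P (partial_sum s @^-1` C `&` X s @^-1` B' `&` tail s.+1 A') =
    (P (partial_sum s @^-1` C) * P (X s @^-1` B') *
      \prod_(s.+1 <= i < n) P (X i @^-1` A' i))%E.
  move=> mA' mB' mC; pose A2 i := if i == s then B' else A' i.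
  have mA2 i : measurable (A2 i) by rewrite /A2; case: ifP.
  have := IH (ltnW sn) A2 mA2 C mC.
  rewrite tailS// big_ltn// {1 3}/A2 eqxx setIA muleA.
  rewrite (eq_tail s.+1 A2 A'); last first.
    by move=> i /andP[si _]; rewrite /A2 gtn_eqF.
  move=> ->; congr (_ * _)%E; apply: eq_big_nat => i /andP[si _].
  by rewrite /A2 gtn_eqF.
have Ptail A' : (forall i, measurable (A' i)) ->
    P (tail s.+1 A') = (\prod_(s.+1 <= i < n) P (X i @^-1` A' i))%E.
  move=> mA'; have := key A' setT setT mA' measurableT measurableT.
  by rewrite !preimage_setT !setTI probability_setT !mul1e.
pose C : set (R * R) := [set z | B (z.1 + z.2)].
have mC : measurable C.
  rewrite (_ : C = (fun z : R * R => z.1 + z.2) @^-1` B) //.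
  rewrite -[X in measurable X]setTI.
  by apply: (measurable_funD measurable_fst measurable_snd).
have sumS : partial_sum s.+1 @^-1` B = (fun w => (partial_sum s w, X s w)) @^-1` C.
  by apply/seteqP; split => w; rewrite /partial_sum/C/= big_nat_recr.
have law A' (mA' : forall i, measurable (A' i)) :=
  @product_law_event (partial_sum s) (X s) (tail s.+1 A') (measurable_tail s.+1 A' mA').
rewrite sumS law//; last by move=> C' B' mC' mB'; rewrite key// Ptail.
(* With the whole space as event, the product measure of [C] is recognised as the probability that
   the longer sum lies in [B]. *)
have := @product_law_event (partial_sum s) (X s) setT measurableT _ C mC.
rewrite setIT probability_setT mule1 => ->; first by rewrite Ptail.
move=> C' B' mC' mB'; rewrite setIT mule1.
have := key (fun=> setT) B' C' (fun=> measurableT) mB' mC'.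
rewrite tailT setIT => ->; rewrite big1 ?mule1// => i _.
by rewrite preimage_setT probability_setT.
Qed.

Lemma partial_sum_independent (ind : mutually_independent) s A B : (s < n)%N ->
  measurable A -> measurable B ->
  P (partial_sum s @^-1` A `&` X s @^-1` B) =
  (P (partial_sum s @^-1` A) * P (X s @^-1` B))%E.
Proof.
move=> sn mA mB; pose A2 i := if i == s then B else setT.
have mA2 i : measurable (A2 i) by rewrite /A2; case: ifP.
have := partial_sum_tail ind s A2 A (ltnW sn) mA2 mA.
rewrite tailS// big_ltn// {1 3}/A2 eqxx.
rewrite (eq_tail s.+1 A2 (fun=> setT)); last first.
  by move=> i /andP[si _]; rewrite /A2 gtn_eqF.
rewrite tailT setIT => ->; rewrite big_nat big1 ?mule1// => i /andP[si _].
by rewrite /A2 gtn_eqF// preimage_setT probability_setT.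
Qed.

(** Expand (S + X)^4 for the next variable X: the terms with an odd power of S or X have expectation
    0, and the middle one contributes 6 s v^2. The form C (s v)^2 is preserved because C (s + 1)^2
    exceeds C s^2 + C by 2 C s, and 2 C >= 6. *)
Lemma partial_sum_moments (ind : mutually_independent) (v C : R) : 3 <= C ->
  (forall i, (i < n)%N -> P.-integrable setT (EFin \o (fun w => X i w ^+ 4))) ->
  (forall i, (i < n)%N -> \int[P]_w X i w = 0) ->
  (forall i, (i < n)%N -> \int[P]_w (X i w ^+ 2) = v) ->
  (forall i, (i < n)%N -> \int[P]_w (X i w ^+ 4) <= C * v ^+ 2) ->
  forall s, (s <= n)%N ->
  [/\ P.-integrable setT (EFin \o (fun w => partial_sum s w ^+ 4)),
     \int[P]_w partial_sum s w = 0,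
     \int[P]_w (partial_sum s w ^+ 2) = s%:R * v &
     \int[P]_w (partial_sum s w ^+ 4) <= C * (s%:R * v) ^+ 2].
Proof.
move=> C3 I4 E1 E2 E4; elim=> [|s IH] sn.
  have S0 : partial_sum 0 = cst 0 by apply/funext => w; rewrite /partial_sum big_nil.
  rewrite S0; split.
  - exact: (integrable_cstr _ _ _ P (0 ^+ 4)).
  - exact: Rintegral_prob_cst.
  - by rewrite /= expr0n Rintegral_prob_cst mul0r.
  - by rewrite /= expr0n Rintegral_prob_cst/= mul0r expr0n mulr0.
have [IS4 ES1 ES2 ES4] := IH (ltnW sn).
have IX k : (k <= 4)%N -> P.-integrable setT (EFin \o (fun w => X s w ^+ k)).
  by apply: integrable_powers => //; exact: I4.
have IS k : (k <= 4)%N -> P.-integrable setT (EFin \o (fun w => partial_sum s w ^+ k)).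
  by apply: integrable_powers => //; exact: measurable_partial_sum.
have prod j k : (j <= 4)%N -> (k <= 4)%N ->
   P.-integrable setT (EFin \o (fun w => partial_sum s w ^+ j * X s w ^+ k)) /\
   \int[P]_w (partial_sum s w ^+ j * X s w ^+ k) =
   \int[P]_w (partial_sum s w ^+ j) * \int[P]_w (X s w ^+ k).
  move=> j4 k4; apply: (independent_pair_expectation (partial_sum s : {RV P >-> R}) (X s)
    (fun x => x ^+ j) (fun x => x ^+ k)).
  - by move=> A B mA mB; exact: partial_sum_independent.
  - exact: measurable_funX.
  - exact: measurable_funX.
  - exact: IS.
  - exact: IX.
have recr w : partial_sum s.+1 w = partial_sum s w + X s w.
  by rewrite /partial_sum big_nat_recr.
have [I31 E31] := prod 3 1 isT isT; have [I22 E22] := prod 2 2 isT isT.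
have [I13 E13] := prod 1 3 isT isT; have [I11 E11] := prod 1 1 isT isT.
have S4 : (fun w => partial_sum s.+1 w ^+ 4) = (fun w => partial_sum s w ^+ 4 +
   (4 * (partial_sum s w ^+ 3 * X s w ^+ 1) + (6 * (partial_sum s w ^+ 2 * X s w ^+ 2) +
   (4 * (partial_sum s w ^+ 1 * X s w ^+ 3) + X s w ^+ 4)))).
  by apply/funext => w; rewrite recr; ring.
have S2 : (fun w => partial_sum s.+1 w ^+ 2) = (fun w => partial_sum s w ^+ 2 +
   (2 * (partial_sum s w ^+ 1 * X s w ^+ 1) + X s w ^+ 2)).
  by apply/funext => w; rewrite recr; ring.
have S1 : (fun w => partial_sum s.+1 w) = (fun w => partial_sum s w + X s w).
  by apply/funext.
have vv : 0 <= v ^+ 2 by exact: sqr_ge0.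
have sv : 0 <= s%:R * v ^+ 2 by rewrite mulr_ge0.
split.
- rewrite S4; do !apply: integrable_EFinD => //; try exact: integrable_EFinZ.
  exact: IX.
- rewrite S1 RintegralD ?ES1 ?E1 ?addr0//; [exact: (IS 1%N)|exact: (IX 1%N)].
- rewrite S2 RintegralD//; [|exact: IS|
    by apply: integrable_EFinD; [exact: integrable_EFinZ|exact: IX]].
  rewrite RintegralD//; [|exact: integrable_EFinZ|exact: IX].
  rewrite RintegralZl// E11 ES2 E2// (E1 s sn : \int[P]_w (X s w ^+ 1) = 0).
  by rewrite -natr1; ring.
rewrite S4.
rewrite RintegralD//; [|do !apply: integrable_EFinD => //; try exact: integrable_EFinZ; exact: IX].
rewrite RintegralD//; [|exact: integrable_EFinZ|
  do !apply: integrable_EFinD => //; try exact: integrable_EFinZ; exact: IX].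
rewrite RintegralD//; [|exact: integrable_EFinZ|
  do !apply: integrable_EFinD => //; try exact: integrable_EFinZ; exact: IX].
rewrite RintegralD//; [|exact: integrable_EFinZ|exact: IX].
rewrite !RintegralZl// E31 E22 E13 ES2 E2//.
rewrite (E1 s sn : \int[P]_w (X s w ^+ 1) = 0) (ES1 : \int[P]_w (partial_sum s w ^+ 1) = 0).
have := E4 s sn; rewrite -natr1.
have : (C - 3) * (s%:R * v ^+ 2) >= 0 by rewrite mulr_ge0// subr_ge0.
lra.
Qed.

End partial_sums.

End independence.

(** * Coordinates and unit vectors in the sequence space *)

Section l2_facts.
Context {R : realType}.
Implicit Types x y : l2 R.

Lemma cvg_series_delta (u : nat -> R) m : (forall i, i != m -> u i = 0) ->
  series u @ \oo --> u m.
Proof.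
move=> u0; apply: cvg_near_cst; exists m.+1 => // N /= mN.
rewrite /series/= (bigD1_seq m)/= ?mem_index_iota ?iota_uniq//.
by rewrite big1 ?addr0// => i im; exact: u0.
Qed.

Lemma l2_unit_subproof m : (fun i => (i == m)%:R : R) \in square_summable.
Proof.
apply/square_summableP; apply/cvg_ex; exists (1 ^+ 2).
have := @cvg_series_delta (fun i => (i == m)%:R ^+ 2) m; rewrite eqxx; apply => i.
by move=> /negbTE ->; rewrite expr0n.
Qed.

Definition l2_unit m : l2 R := L2 (l2_unit_subproof m).

Lemma l2_dot_unitr x m : l2_dot x (l2_unit m) = x m.
Proof.
apply: cvg_lim => //; have := @cvg_series_delta (fun i => x i * l2_unit m i) m.
rewrite /= eqxx mulr1; apply => i /negbTE/= ->; exact: mulr0.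
Qed.

Lemma l2_dot_unitl (a : R) m x : l2_dot (a *: l2_unit m) x = a * x m.
Proof.
apply: cvg_lim => //.
have := @cvg_series_delta (fun i => (a *: l2_unit m) i * x i) m.
rewrite (_ : (a *: l2_unit m) m = a * (m == m)%:R)// eqxx mulr1; apply => i im.
by rewrite (_ : (a *: l2_unit m) i = a * (i == m)%:R)// (negbTE im) mulr0 mul0r.
Qed.

Lemma l2_dot0l x : l2_dot 0 x = 0.
Proof. by have := l2_dot_unitl 0 0 x; rewrite scale0r mul0r. Qed.

Lemma l2_cvg_sqr x : cvgn (series (fun m => x m ^+ 2)).
Proof. by apply/square_summableP; exact: (valP x). Qed.

Lemma l2_sum_sqr_le x k N : \sum_(k <= i < N) x i ^+ 2 <= `|x| ^+ 2.
Proof.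
have nd : nondecreasing_seq (series (fun m => x m ^+ 2)).
  apply/nondecreasing_seqP => i.
  by rewrite /series/= big_nat_recr//= lerDl sqr_ge0.
have le M : \sum_(0 <= i < M) x i ^+ 2 <= limn (series (fun m => x m ^+ 2)).
  exact: nondecreasing_cvgn_le nd (l2_cvg_sqr x) M.
rewrite -[`|x|]/(l2_norm x) sqr_sqrtr; last by have := le 0; rewrite big_nil.
apply: le_trans (le (maxn k N)).
rewrite (@big_cat_nat _ _ _ k 0 (maxn k N))//= ?leq_maxl//.
have s0 i j : 0 <= \sum_(i <= l < j) x l ^+ 2.
  by apply: sumr_ge0 => l _; exact: sqr_ge0.
have [kN|Nk] := leqP k N; first by rewrite lerDr.
by rewrite big_geq ?addr_ge0// ltnW.
Qed.

Lemma l2_coord_le x m : `|x m| <= `|x|.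
Proof.
rewrite -(@ler_sqr _ `|x m|) ?nnegrE// real_normK ?num_real//.
by have := l2_sum_sqr_le x m m.+1; rewrite big_nat1.
Qed.

Lemma l2_coord0 m : (0 : l2 R) m = 0. Proof. by []. Qed.

Lemma l2_coordN x m : (- x) m = - x m. Proof. by []. Qed.

Lemma l2_coordB x y m : (x - y) m = x m - y m. Proof. by []. Qed.

Lemma l2_coordZ_unit (a : R) j m : (a *: l2_unit j) m = a * (m == j)%:R.
Proof. by []. Qed.

Lemma l2_coord_sum (I : Type) (r : seq I) (Q : pred I) (F : I -> l2 R) m :
  (\sum_(i <- r | Q i) F i) m = \sum_(i <- r | Q i) F i m.
Proof. by elim/big_rec2 : _ => // i z t _ <-. Qed.

Lemma l2_norm_unit m : `|l2_unit m| = 1.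
Proof.
rewrite -[LHS]/(l2_norm (l2_unit m)) /l2_norm (_ : limn _ = 1 :> R) ?sqrtr1//.
apply: cvg_lim => //; have := @cvg_series_delta (fun i => (i == m)%:R ^+ 2) m.
rewrite eqxx expr1n; apply => i.
by move=> /negbTE ->; rewrite expr0n.
Qed.

(** Coordinates are 1-Lipschitz, so preimages of open intervals are open and hence Borel. *)
Lemma measurable_l2_coord m : measurable_fun setT (fun x : l2 R => x m).
Proof.
have cont : continuous (fun x : l2 R => x m).
  move=> x; have Fx : Filter (nbhs x) := nbhs_filter x.
  apply/(@cvgrPdist_lt _ _ _ (nbhs x) Fx) => e e0.
  apply: filterS (nbhsx_ballx x e e0) => y; rewrite -ball_normE /= => xy.
  by rewrite -l2_coordB (le_lt_trans (l2_coord_le _ _)).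
apply: (measurability _ (RGenOpens.measurableE R)) => _ [_ [a [b ->] <-]].
rewrite setTI; apply: sub_sigma_algebra.
by move/continuousP : cont; apply; exact: interval_open.
Qed.

End l2_facts.

(** * The random vector Z: opposite atoms on the coordinate axes *)

Section signed_atoms.
Context {R : realType} (s2 : nat -> R) (a : R).
Hypothesis s20 : forall i, 0 <= s2 i.
Hypothesis cs2 : cvgn (series s2).
Hypothesis a0 : 0 < a.
Hypothesis sa : limn (series s2) <= a ^+ 2.

(** The mass of each of the two points of the [i]-th pair. Index [j.+1] belongs to the axis of
    coordinate [j]; index 0 gets the mass left over, which is nonnegative by [sa]. *)
Definition atom_weight (i : nat) : R :=
  if i is j.+1 then s2 j / (2 * a ^+ 2)
  else (1 - limn (series s2) / a ^+ 2) / 2.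

Lemma atom_weight_ge0 i : 0 <= atom_weight i.
Proof.
case: i => [|i] /=; last by rewrite divr_ge0// mulr_ge0// sqr_ge0.
by rewrite divr_ge0// subr_ge0 ler_pdivrMr ?mul1r// exprn_gt0.
Qed.

(* The points 2 i and 2 i + 1 carry opposite vectors of equal weight; i = 0 stands
   for the zero vector, which takes the remaining mass. *)
Definition signed_atom (w : nat) : l2 R :=
  (-1) ^+ odd w *: (if w./2 is j.+1 then a *: l2_unit j else 0).

(** Z lives on the natural numbers with all sets measurable, so every function on this space is
    measurable. *)
Definition signed_atom_measure : set nat -> \bar R :=
  mseries (fun i => mscale (NngNum (atom_weight_ge0 i))
    (measure_add (\d_(i.*2)) (\d_(i.*2.+1)))) 0.

HB.instance Definition _ := Measure.on signed_atom_measure.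

Lemma ge0_integral_signed_atoms (f : nat -> \bar R) : (forall w, 0 <= f w)%E ->
  (\int[signed_atom_measure]_w f w =
   \sum_(i <oo) (atom_weight i)%:E * (f i.*2 + f i.*2.+1))%E.
Proof.
move=> f0; have mf : measurable_fun setT f by [].
rewrite ge0_integral_measure_series//; apply: eq_eseriesr => i _.
rewrite ge0_integral_mscale//= ge0_integral_measure_add//.
by rewrite !integral_dirac// !diracT !mul1e.
Qed.

Lemma signed_atom_measure_setT : signed_atom_measure setT = 1%E.
Proof.
rewrite -[LHS]mul1e -integral_cst// ge0_integral_signed_atoms//.
apply: cvg_lim => //; rewrite -cvg_shiftS.
have -> : (fun N => \sum_(0 <= i < N.+1) (atom_weight i)%:E * (1 + 1))%E =
    (fun N => ((1 - limn (series s2) / a ^+ 2) + (a ^+ 2)^-1 * series s2 N)%:E).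
  apply/funext => N; rewrite big_nat_recl//=.
  have -> : (1 + 1 = 2%:E :> \bar R)%E by rewrite -EFinD.
  under eq_bigr do rewrite -EFinM.
  rewrite sumEFin -!EFinM -EFinD; congr EFin; congr (_ + _).
    by field; rewrite gt_eqF.
  rewrite /series/= mulr_sumr; apply: eq_bigr => i _.
  by field; rewrite gt_eqF.
suff h : (1 - limn (series s2) / a ^+ 2) + (a ^+ 2)^-1 * series s2 N @[N --> \oo] --> (1 : R).
  by apply/fine_cvgP; split; [exact: nearW|exact: h].
have {2}-> : (1 : R) = 1 - limn (series s2) / a ^+ 2 + (a ^+ 2)^-1 * limn (series s2) by ring.
apply: cvgD; first exact: cvg_cst.
by apply: cvgM => //; exact: cvg_cst.
Qed.

HB.instance Definition _ :=
  Measure_isProbability.Build _ _ _ signed_atom_measure signed_atom_measure_setT.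

Lemma measurable_signed_atom : measurable_fun setT signed_atom.
Proof. by []. Qed.

HB.instance Definition _ :=
  isMeasurableFun.Build _ _ _ _ signed_atom measurable_signed_atom.

Lemma signed_atom_double i : signed_atom i.*2 = if i is j.+1 then a *: l2_unit j else 0.
Proof. by rewrite /signed_atom odd_double doubleK expr0 scale1r. Qed.

Lemma signed_atom_doubleS i : signed_atom i.*2.+1 = - signed_atom i.*2.
Proof.
rewrite signed_atom_double /signed_atom /= odd_double /= uphalf_double.
by rewrite expr1 scaleN1r.
Qed.

Lemma signed_atom_norm w : `|signed_atom w| <= a.
Proof.
rewrite /signed_atom normrZ normrX normrN1 expr1n mul1r.
case: (w./2) => [|j]; first by rewrite normr0 ltW.
by rewrite normrZ l2_norm_unit mulr1 gtr0_norm.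
Qed.

Lemma signed_atom_coord w m : [\/ signed_atom w m = 0, signed_atom w m = a |
  signed_atom w m = - a].
Proof.
rewrite -[signed_atom w m]/((-1) ^+ odd w * l2_seq _ m).
case: (w./2) => [|j]; first by constructor 1; rewrite -[l2_seq _ m]/0 mulr0.
rewrite -[l2_seq _ m]/(a * (m == j)%:R).
case: eqP => _; last by constructor 1; rewrite !mulr0.
by case: (odd w); [constructor 3; rewrite mulr1 expr1 mulN1r|
  constructor 2; rewrite mulr1 expr0 mul1r].
Qed.

(** Swapping the two points of each pair exchanges the positive and negative parts of [f], so their
    integrals agree; the bound [M] makes them finite, hence they cancel. *)
Lemma signed_atom_odd_expectation (f : nat -> R) (M : R) :
  (forall w, `|f w| <= M) -> (forall i, f i.*2.+1 = - f i.*2) ->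
  ('E_signed_atom_measure[f] = 0)%E.
Proof.
move=> fM fodd; have mf : measurable_fun setT f by [].
have If : signed_atom_measure.-integrable setT (EFin \o f).
  apply: (le_norm_integrable _ _ _ _ _ (cst M)) => //; exact: integrable_cstr.
rewrite unlock integralE.
rewrite [X in (_ - X)%E](_ : _ = \int[signed_atom_measure]_w ((EFin \o f)^\+ w)%E)%E.
  rewrite subee//; exact: integrable_pos_fin_num.
rewrite !ge0_integral_signed_atoms//; apply: eq_eseriesr => i _.
rewrite addeC; congr (_ * (_ + _))%E.
  by rewrite funeposE funenegE /= fodd opprK.
by rewrite funeposE funenegE /= fodd.
Qed.

Definition signed_atom_RV : {RV signed_atom_measure >-> l2 R} := signed_atom.

Lemma signed_atom_mean : has_mean signed_atom_RV 0.
Proof.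
move=> h; rewrite l2_dot0l.
have dot w : l2_dot (signed_atom w) h =
    (-1) ^+ odd w * (if w./2 is j.+1 then a * h j else 0).
  rewrite /signed_atom; case: (w./2) => [|j]; first by rewrite scaler0 l2_dot0l mulr0.
  by rewrite scalerA l2_dot_unitl mulrA.
apply: (@signed_atom_odd_expectation _ (a * `|h|)) => [w|i]; rewrite /= !dot.
  rewrite normrM normrX normrN1 expr1n mul1r.
  case: (w./2) => [|j]; first by rewrite normr0 mulr_ge0// ltW.
  by rewrite normrM gtr0_norm// ler_pM2l// l2_coord_le.
by rewrite /= !odd_double uphalf_double doubleK /= expr0 expr1 mul1r mulN1r.
Qed.

Lemma signed_atom_coord_mean m : ('E_signed_atom_measure[fun w => signed_atom w m] = 0)%E.
Proof.
have mean0 := signed_atom_mean (l2_unit m).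
rewrite l2_dot0l in mean0; rewrite -[RHS]mean0.
by congr expectation; apply/funext => w; rewrite l2_dot_unitr.
Qed.

(** Each atom has at most one nonzero coordinate, so the product of two different coordinates
    vanishes pointwise. *)
Lemma signed_atom_covariance i j : i <> j ->
  covariance signed_atom_measure (fun w => signed_atom w i) (fun w => signed_atom w j) = 0%E.
Proof.
move=> ij; rewrite unlock !signed_atom_coord_mean/=.
rewrite (_ : (_ * _)%R = cst 0); first by rewrite expectation_cst.
apply/funext => w; rewrite /= -[LHS]/((signed_atom w i - 0) * (signed_atom w j - 0)).
rewrite !subr0 -[signed_atom w i]/((-1) ^+ odd w * l2_seq _ i).
rewrite -[signed_atom w j]/((-1) ^+ odd w * l2_seq _ j).
case: (w./2) => [|l]; first by rewrite -[l2_seq _ i]/0 mulr0 mul0r.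
rewrite -[l2_seq _ i]/(a * (i == l)%:R) -[l2_seq _ j]/(a * (j == l)%:R).
case: eqVneq => [il|_]; last by rewrite !mulr0 mul0r.
by case: eqVneq => [jl|_]; [case: ij; rewrite il jl|rewrite !mulr0].
Qed.

Lemma signed_atom_coord_second_moment m :
  ('E_signed_atom_measure[fun w => (signed_atom w m ^+ 2)%R] = (s2 m)%:E)%E.
Proof.
rewrite unlock ge0_integral_signed_atoms; last by move=> w; rewrite lee_fin sqr_ge0.
(* Only the pair on axis [m] contributes, namely twice a^2 with weight [s2 m / (2 * a ^+ 2)]. *)
have eq i : ((atom_weight i)%:E * ((signed_atom i.*2 m ^+ 2)%:E +
     (signed_atom i.*2.+1 m ^+ 2)%:E) = (if i == m.+1 then s2 m else 0)%:E)%E.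
  rewrite signed_atom_doubleS l2_coordN sqrrN.
  rewrite signed_atom_double -EFinD -EFinM; congr EFin.
  case: i => [|i]; first by rewrite l2_coord0 expr0n addr0 mulr0.
  rewrite l2_coordZ_unit eqSS eq_sym.
  case: eqP => [->|_]; last by rewrite mulr0 expr0n addr0 mulr0.
  by rewrite mulr1 /=; field; rewrite gt_eqF.
under eq_eseriesr do rewrite eq.
apply: cvg_lim => //; apply: cvg_near_cst; exists m.+2 => // N /= mN.
rewrite sumEFin; congr EFin.
rewrite (bigD1_seq m.+1)/= ?mem_index_iota ?iota_uniq// eqxx.
by rewrite big1 ?addr0// => i /negbTE ->.
Qed.

Lemma signed_atom_variance m :
  covariance signed_atom_measure (fun w => signed_atom w m) (fun w => signed_atom w m) =
  (s2 m)%:E.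
Proof.
rewrite unlock signed_atom_coord_mean/= -signed_atom_coord_second_moment.
congr expectation; apply/funext => w.
by rewrite -[LHS]/((signed_atom w m - 0) * (signed_atom w m - 0)) subr0 expr2.
Qed.

Lemma signed_atom_norm_moment (gamma : R) : 0 <= gamma ->
  ('E_signed_atom_measure[fun w => (`|signed_atom w| `^ gamma)%R] < +oo)%E.
Proof.
move=> g0; apply: (@le_lt_trans _ _ (a `^ gamma)%:E); last exact: ltry.
rewrite -(expectation_cst signed_atom_measure).
apply: expectation_le => //; last 1 first.
  apply: aeW => w; apply: ge0_ler_powR => //; rewrite ?nnegrE ?(ltW a0)//.
  exact: signed_atom_norm.
by move=> w; exact: powR_ge0.
Qed.

End signed_atoms.

(** * Deviations, distance to the lattice, and a weighted Cauchy-Schwarz inequality *)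

Section deviations.
Context {R : realType}.

Lemma Delta_ge0 (V : zmodType) (N : V -> R) n (x y : 'I_n -> V) : 0 <= Delta N x y.
Proof. exact: bigmax_ge_id. Qed.

(** The full sums are the last term of the maximum; the tail part of the lower bound looks at this
    time only. *)
Lemma Delta_total_sum (V : zmodType) (N : V -> R) n (x y : 'I_n.+1 -> V) :
  N (\sum_j x j - \sum_j y j) <= Delta N x y.
Proof.
rewrite /Delta; apply: le_trans (le_bigmax _ _ ord_max) => /=.
rewrite le_eqVlt; apply/orP; left; apply/eqP; congr (N (_ - _)).
  by apply: eq_bigl => j; rewrite leq_ord.
by apply: eq_bigl => j; rewrite leq_ord.
Qed.

Lemma eucl_norm_first_coords_le k (x : l2 R) : eucl_norm (first_coords k x) <= `|x|.
Proof.
rewrite -[`|x|]ger0_norm// -sqrtr_sqr ler_sqrt ?sqr_ge0//.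
under eq_bigr do rewrite mxE.
by have := l2_sum_sqr_le x 0 k; rewrite big_mkord.
Qed.

Lemma Delta_first_coords_le k n (x y : 'I_n -> l2 R) :
  Delta (@eucl_norm R k) (fun j => first_coords k (x j)) (fun j => first_coords k (y j)) <=
  Delta (fun z : l2 R => `|z|) x y.
Proof.
apply: le_bigmax2 => s _; apply: le_trans (eucl_norm_first_coords_le k _).
rewrite le_eqVlt; apply/orP; left; apply/eqP; congr eucl_norm.
apply/rowP => i; rewrite !mxE !summxE l2_coordB !l2_coord_sum.
by congr (_ - _); apply: eq_bigr => j _; rewrite mxE.
Qed.

(* If |t| <= a / 2, then 0 is a point of the lattice nearest to t; otherwise the
   left-hand side is negative. *)
Lemma lattice_distance_ge (a s t : R) (z : int) : 0 < a -> s = a * z%:~R ->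
  t ^+ 2 - 4 / a ^+ 2 * t ^+ 4 <= (s - t) ^+ 2.
Proof.
move=> a0 sz; have a20 : 0 < a ^+ 2 by rewrite exprn_gt0.
have t4 : t ^+ 4 = t ^+ 2 * t ^+ 2 by ring.
have [at2|ta2] := lerP (a ^+ 2) (4 * t ^+ 2).
  apply: (@le_trans _ _ 0); last exact: sqr_ge0.
  have : 1 <= 4 / a ^+ 2 * t ^+ 2 by rewrite mulrAC ler_pdivlMr// mul1r.
  rewrite t4 mulrA => h; have := ler_wpM2r (sqr_ge0 t) h; lra.
apply: (@le_trans _ _ (t ^+ 2)).
  by rewrite gerBl mulr_ge0// ?divr_ge0 ?exprn_even_ge0// ltW.
have [z0|z0] := eqVneq z 0; first by rewrite sz z0 mulr0 sub0r sqrrN.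
have ta : `|t| <= a / 2.
  rewrite -(@ler_sqr _ `|t|) ?nnegrE ?divr_ge0 ?(ltW a0)// real_normK ?num_real//.
  by rewrite expr_div_n ler_pdivlMr; [lra|lra].
have sa : a <= `|s|.
  rewrite sz normrM gtr0_norm// ler_pMr// -intr_norm.
  by rewrite ler1z -gtz0_ge1 normr_gt0.
rewrite -(real_normK (num_real t)) -(real_normK (num_real (s - t))).
rewrite ler_sqr ?nnegrE//.
have := lerB_dist s t; lra.
Qed.

(** Cauchy-Schwarz with weights [v], from the quadratic in [c] given by the sum of v_i (t_i / v_i -
    c)^2, which is nonnegative; its minimum is at c = A / V. *)
Lemma sqr_sum_le (I : Type) (r : seq I) (t v : I -> R) : (forall i, 0 < v i) ->
  (\sum_(i <- r) t i) ^+ 2 <= (\sum_(i <- r) v i) * \sum_(i <- r) t i ^+ 2 / v i.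
Proof.
move=> v0; set A := \sum_(i <- r) t i; set V := \sum_(i <- r) v i.
set B := \sum_(i <- r) _ / _.
have expand c : \sum_(i <- r) v i * (t i / v i - c) ^+ 2 = B - 2 * c * A + c ^+ 2 * V.
  rewrite /A /B /V !mulr_sumr -sumrB -big_split/=; apply: eq_bigr => i _.
  by field; rewrite gt_eqF.
have ge0 c : 0 <= B - 2 * c * A + c ^+ 2 * V.
  by rewrite -expand sumr_ge0// => i _; rewrite mulr_ge0 ?sqr_ge0// ltW.
have : 0 <= V by apply: sumr_ge0 => i _; exact: ltW.
rewrite le_eqVlt => /predU1P[V0|V0].
  have B0 : 0 <= B by apply: sumr_ge0 => i _; rewrite divr_ge0 ?sqr_ge0// ltW.
  rewrite -V0 mul0r exprn_even_le0//=; apply/eqP.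
  have [//|A0] := eqVneq A 0.
  (* For V = 0 the quadratic degenerates to B - 2 c A, and this [c] would make it -1. *)
  have := ge0 ((B + 1) / (2 * A)); rewrite -V0 mulr0 addr0.
  have -> : 2 * ((B + 1) / (2 * A)) * A = B + 1 by field.
  lra.
have := mulr_ge0 (ltW V0) (ge0 (A / V)).
have -> : V * (B - 2 * (A / V) * A + (A / V) ^+ 2 * V) = V * B - A ^+ 2.
  by field; rewrite gt_eqF.
by rewrite subr_ge0.
Qed.

End deviations.

(** * Lower bounds for the moments of the deviation *)

Section lower_bounds.
Context d (T : measurableType d) (R : realType) (P : probability T R).

(** The integral of a nonnegative function is a supremum over the simple functions below it, hence
    monotone for arbitrary functions. Moments of [Delta] can thus be compared without discussing its
    measurability. *)
Lemma le_integral_nonmeasurable (f g : T -> \bar R) :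
  (forall x, 0 <= f x)%E -> (forall x, f x <= g x)%E ->
  (\int[P]_x f x <= \int[P]_x g x)%E.
Proof.
move=> f0 fg; have g0 x : (0 <= g x)%E by exact: le_trans (f0 x) (fg x).
rewrite !ge0_integralTE//; apply: le_ereal_sup => _ [h /= hf <-].
by exists h => // x; exact: le_trans (hf x) (fg x).
Qed.

(** Paley-Zygmund for [W] of any sign, with the second moment placed on the majorant [Q]. Off the
    event W < V / 4; on it W <= Q^2 / (8 C V) + 2 C V. Taking expectations, V / 2 <= V / 4 + V / 8 +
    2 C V p, where p is the probability of the event. *)
Lemma probability_ge_of_second_moment (W Q : T -> R) (V C : R) :
  0 < V -> 0 < C -> P.-integrable setT (EFin \o W) ->
  P.-integrable setT (EFin \o (fun w => Q w ^+ 2)) ->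
  (forall w, W w <= Q w) -> V / 2 <= \int[P]_w W w ->
  \int[P]_w (Q w ^+ 2) <= C * V ^+ 2 ->
  (((16 * C)^-1)%:E <= P [set w | (V / 4 <= W w)%R])%E.
Proof.
move=> V0 C0 IW IQ WQ EW EQ; set A := [set w | _].
have mW : measurable_fun setT W by apply/measurable_EFinP; exact: (measurable_int P).
have mA : measurable A.
  rewrite (_ : A = W @^-1` `[V / 4, +oo[%classic).
    by rewrite -[X in measurable X]setTI; exact: mW.
  by apply/seteqP; split => w; rewrite /A/= in_itv/= andbT.
have IA : P.-integrable setT (EFin \o \1_A) by exact: integrable_indic.
have C8 : 0 < 8 * C * V by rewrite !mulr_gt0.
have bound w : W w <= V / 4 + ((8 * C * V)^-1 * Q w ^+ 2 + 2 * C * V * \1_A w).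
  rewrite indicE; case: (boolP (w \in A)) => [wA|/negP wA].
    rewrite mulr1; apply: le_trans (WQ w) _.
    (* AM-GM: [Q <= Q^2 / (8 C V) + 2 C V] *)
    have : 0 <= (8 * C * V)^-1 * (Q w - 4 * C * V) ^+ 2.
      by rewrite mulr_ge0 ?sqr_ge0// invr_ge0 ltW.
    have -> : (8 * C * V)^-1 * (Q w - 4 * C * V) ^+ 2 =
      (8 * C * V)^-1 * Q w ^+ 2 - Q w + 2 * C * V.
      by field; rewrite !gt_eqF.
    lra.
  have {}wA : W w < V / 4.
    by rewrite ltNge; apply/negP => h; apply: wA; rewrite inE.
  have : 0 <= (8 * C * V)^-1 * Q w ^+ 2 by rewrite mulr_ge0 ?sqr_ge0// invr_ge0 ltW.
  rewrite mulr0; lra.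
have : \int[P]_w W w <= \int[P]_w (V / 4 + ((8 * C * V)^-1 * Q w ^+ 2 + 2 * C * V * \1_A w)).
  apply: le_Rintegral => //.
  by do !apply: integrable_EFinD; [exact: integrable_cstr|
    exact: integrable_EFinZ|exact: integrable_EFinZ].
rewrite RintegralD//; [|exact: integrable_cstr|by apply: integrable_EFinD; exact: integrable_EFinZ].
rewrite RintegralD//; [|exact: integrable_EFinZ|exact: integrable_EFinZ].
rewrite Rintegral_prob_cst !RintegralZl//.
have -> : \int[P]_w \1_A w = fine (P A) by rewrite /Rintegral integral_indic// setIT.
have EQ' : (8 * C * V)^-1 * \int[P]_w (Q w ^+ 2) <= V / 8.
  rewrite mulrC ler_pdivrMr// (le_trans EQ)//.
  by rewrite (_ : V / 8 * (8 * C * V) = C * V ^+ 2)//; field.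
move=> h; rewrite -[leRHS]fineK ?fin_num_measure// lee_fin.
rewrite -[leLHS]mul1r ler_pdivrMr ?mulr_gt0//.
rewrite -(ler_pM2l V0) mulr1; lra.
Qed.

Definition l2_coord_fun (X : T -> l2 R) (m : nat) : T -> R := fun w => X w m.

Lemma measurable_l2_coord_fun (X : {RV P >-> l2 R}) m :
  measurable_fun setT (l2_coord_fun X m).
Proof. exact: measurableT_comp (measurable_l2_coord m) _. Qed.

HB.instance Definition _ (X : {RV P >-> l2 R}) m :=
  isMeasurableFun.Build _ _ _ _ (l2_coord_fun X m) (measurable_l2_coord_fun X m).

Lemma coordinate_sum_moments n (Y : 'I_n.+1 -> {RV P >-> l2 R}) (m : nat) (v C : R) :
  independent_RVs Y -> 3 <= C ->
  (forall j, 'E_P[fun w => Y j w m] = 0)%E ->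
  (forall j, \int[P]_w (Y j w m ^+ 2)%:E = v%:E)%E ->
  (forall j, \int[P]_w (Y j w m ^+ 4)%:E <= (C * v ^+ 2)%:E)%E ->
  let S w := \sum_(j < n.+1) Y j w m in
  [/\ measurable_fun setT S,
      P.-integrable setT (EFin \o (fun w => S w ^+ 4)),
      \int[P]_w (S w ^+ 2) = n.+1%:R * v &
      \int[P]_w (S w ^+ 4) <= C * (n.+1%:R * v) ^+ 2].
Proof.
move=> ind C3 E1 E2 E4 S.
(* [inord] turns the finite family into a sequence, of which only the indices below [n.+1] are
   used. *)
pose X (i : nat) : {RV P >-> R} := l2_coord_fun (Y (inord i)) m.
have indX : mutually_independent _ _ _ P X n.+1.
  move=> A mA.
  (* Events of a coordinate are Borel events of the vector, so independence passes from the vectors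
     to their coordinates. *)
  pose A' (j : 'I_n.+1) : set (l2 R) := (fun x : l2 R => x m) @^-1` A j.
  have mA' j : measurable (A' j).
    by rewrite /A' -[X in measurable X]setTI; exact: measurable_l2_coord.
  rewrite big_mkord; have := ind A' mA'.
  rewrite (_ : \bigcap_(i in _) _ = \bigcap_(i in [set i | (0 <= i < n.+1)%N]) X i @^-1` A i).
    move=> ->; apply: eq_bigr => j _; rewrite /A' /X inord_val//.
  apply/seteqP; split => w h i /=.
    move=> i_n; have := h (inord i) I.
    by rewrite /A' /= inordK.
  by move=> _; have := h i (ltn_ord i); rewrite /X /= inord_val.
have moments i : P.-integrable setT (EFin \o (fun w => X i w ^+ 4)) /\
    \int[P]_w (X i w ^+ 4) <= C * v ^+ 2.
  apply: ge0_integrable_le => //.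
  - by apply: measurable_funX; exact: measurable_l2_coord_fun.
  - by move=> w; rewrite exprn_even_ge0.
  - exact: E4.
have SE : S = partial_sum _ _ _ P X n.+1.
  apply/funext => w; rewrite /partial_sum big_mkord; apply: eq_bigr => j _.
  by rewrite /X /= /l2_coord_fun inord_val.
have E1X i : (i < n.+1)%N -> \int[P]_w X i w = 0.
  by move=> _; have := E1 (inord i); rewrite unlock /Rintegral => ->.
have E2X i : (i < n.+1)%N -> \int[P]_w (X i w ^+ 2) = v.
  by move=> _; have := E2 (inord i); rewrite /Rintegral => ->.
have [I4 _ E2' E4'] := partial_sum_moments _ _ _ P X n.+1 indX v C C3
  (fun i _ => (moments i).1) E1X E2X (fun i _ => (moments i).2) n.+1 (leqnn _).
by rewrite SE; split => //; exact: measurable_partial_sum.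
Qed.

Lemma Rintegral_bigsum (I : Type) (r : seq I) (F : I -> T -> R) :
  (forall i, P.-integrable setT (EFin \o F i)) ->
  P.-integrable setT (EFin \o (fun w => \sum_(i <- r) F i w)) /\
  \int[P]_w (\sum_(i <- r) F i w) = \sum_(i <- r) \int[P]_w F i w.
Proof.
move=> IF; elim: r => [|i r [Ir Er]].
  rewrite big_nil (_ : (fun w => _) = cst 0); last first.
    by apply/funext => w; rewrite big_nil.
  by split; [exact: integrable_cstr|exact: Rintegral_prob_cst].
rewrite big_cons (_ : (fun w => _) = (fun w => F i w + \sum_(j <- r) F j w)); last first.
  by apply/funext => w; rewrite big_cons.
by split; [exact: integrable_EFinD|rewrite RintegralD// Er].
Qed.

Lemma probability_setI_full (A Omega : set T) : measurable A -> measurable Omega ->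
  P Omega = 1%E -> (P A <= P (A `&` Omega))%E.
Proof.
move=> mA mO PO; have mAO : measurable (A `&` Omega) by exact: measurableI.
have PC : P (~` Omega) = 0%E by rewrite probability_setC// PO subee.
apply: (@le_trans _ _ (P ((A `&` Omega) `|` ~` Omega))).
  apply: le_measure; rewrite ?inE//; first by apply: measurableU => //; exact: measurableC.
  by move=> w Aw; have [Ow|Ow] := pselect (Omega w); [left|right].
apply: le_trans (measureU2 _ _ _) _ => //; first exact: measurableC.
by rewrite -[X in (_ + X <= _)%E]/(P (~` Omega)) PC adde0.
Qed.

(** The lattice argument on the block of coordinates [k <= m < N], with a constant free of the block
    length. The lattice property is required only on the full event [Omega], since the X's share
    just the law of Z. *)
Lemma deviation_moment_ge n (X Y : 'I_n.+1 -> {RV P >-> l2 R}) (s2 : nat -> R)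
    (a C gamma : R) (k N : nat) (Omega : set T) :
  independent_RVs Y -> 3 <= C -> 0 < a -> 0 <= gamma ->
  (forall m, 0 < s2 m) ->
  (forall m, 8 * C * (n.+1%:R * s2 m) <= a ^+ 2) ->
  (forall j m, 'E_P[fun w => Y j w m] = 0)%E ->
  (forall j m, \int[P]_w (Y j w m ^+ 2)%:E = (s2 m)%:E)%E ->
  (forall j m, \int[P]_w (Y j w m ^+ 4)%:E <= (C * s2 m ^+ 2)%:E)%E ->
  measurable Omega -> P Omega = 1%E ->
  (forall w, Omega w -> forall j m, exists z : int, X j w m = a * z%:~R) ->
  (k < N)%N ->
  forall V, V = n.+1%:R * \sum_(k <= m < N) s2 m ->
  (((V / 4) `^ (gamma / 2) / (16 * C))%:E <=
   'E_P[fun w => (Delta (fun x : l2 R => `|x|) (fun j => X j w) (fun j => Y j w) `^ gamma)%R])%E.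
Proof.
move=> indY C3 a0 g0 s20 sa E1 E2 E4 mO PO lattice kN V defV.
have C0 : 0 < C by lra.
pose S m w := \sum_(j < n.+1) Y j w m.
pose v m := n.+1%:R * s2 m.
have v0 m : 0 < v m by rewrite mulr_gt0.
have VE : V = \sum_(k <= m < N) v m by rewrite defV mulr_sumr.
have V0 : 0 < V.
  rewrite VE big_ltn// ltr_wpDr//; apply: sumr_ge0 => m _; exact: ltW.
have mom m := coordinate_sum_moments n Y m (s2 m) C indY C3
  (fun j => E1 j m) (fun j => E2 j m) (fun j => E4 j m).
have mS m : measurable_fun setT (S m) by case: (mom m).
have IS m : P.-integrable setT (EFin \o (fun w => S m w ^+ 4)) by case: (mom m).
have IS2 m : P.-integrable setT (EFin \o (fun w => S m w ^+ 2)).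
  by apply: (integrable_powers _ _ _ _ _ (mS m) (IS m)).
have ES2 m : \int[P]_w (S m w ^+ 2) = v m by case: (mom m).
have ES4 m : \int[P]_w (S m w ^+ 4) <= C * v m ^+ 2 by case: (mom m).
(* [W] bounds the squared deviation from below on [Omega], and [Q] dominates [W]. Cauchy-Schwarz
   with weights [v m] gives Q^2 <= [G], whose expectation is at most the sum of (V / v_m) C v_m^2,
   that is C V^2. *)
pose W w := \sum_(k <= m < N) (S m w ^+ 2 - 4 / a ^+ 2 * S m w ^+ 4).
pose Q w := \sum_(k <= m < N) S m w ^+ 2.
pose G w := \sum_(k <= m < N) (V / v m) * S m w ^+ 4.
have a2 : 0 < a ^+ 2 by rewrite exprn_gt0.
have IZ c m : P.-integrable setT (EFin \o (fun w => c * S m w ^+ 4)) by exact: integrable_EFinZ.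
have IWm m : P.-integrable setT (EFin \o (fun w => S m w ^+ 2 - 4 / a ^+ 2 * S m w ^+ 4)).
  exact: (integrableB measurableT (IS2 m) (IZ _ m)).
have [IW EW] := Rintegral_bigsum _ (index_iota k N) _ IWm.
have [IQ _] := Rintegral_bigsum _ (index_iota k N) _ IS2.
have [IG EG] := Rintegral_bigsum _ (index_iota k N) _ (fun m => IZ (V / v m) m).
have WQ w : W w <= Q w.
  by apply: ler_sum => m _; rewrite gerBl mulr_ge0// ?divr_ge0// ?exprn_even_ge0.
have QG w : Q w ^+ 2 <= G w.
  apply: le_trans (sqr_sum_le _ _ _ v v0) _; rewrite -VE /G mulr_sumr.
  by apply: ler_sum => m _; rewrite -exprM mulrA mulrAC.
have mQ : measurable_fun setT Q.
  by apply/measurable_EFinP; exact: (measurable_int P).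
have IQ2 : P.-integrable setT (EFin \o (fun w => Q w ^+ 2)).
  apply: (le_norm_integrable _ _ _ _ _ G) => //; first exact: measurable_funX.
  by move=> w; rewrite ger0_norm ?sqr_ge0.
have EWge : V / 2 <= \int[P]_w W w.
  rewrite /W EW VE mulr_suml; apply: ler_sum => m _.
  rewrite RintegralB//.
  rewrite RintegralZl// ES2.
  (* Here the size of [a] enters: 4 C v_m^2 / a^2 <= v_m / 2 because 8 C v_m <= a^2. *)
  have : 4 / a ^+ 2 * \int[P]_w (S m w ^+ 4) <= v m / 2.
    rewrite mulrAC ler_pdivrMr//.
    have := ler_wpM2l (ltW (v0 m)) (sa m); have := ES4 m; rewrite -/(v m).
    lra.
  lra.
have EQle : \int[P]_w (Q w ^+ 2) <= C * V ^+ 2.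
  apply: (@le_trans _ _ (\int[P]_w G w)); first exact: le_Rintegral.
  rewrite /G EG (_ : C * V ^+ 2 = \sum_(k <= m < N) V / v m * (C * v m ^+ 2)).
    apply: ler_sum => m _; rewrite RintegralZl//.
    by rewrite ler_wpM2l// divr_ge0// ltW.
  rewrite expr2 {2}VE !mulr_sumr; apply: eq_bigr => m _.
  by field; rewrite gt_eqF.
have := probability_ge_of_second_moment W Q V C V0 C0 IW IQ2 WQ EWge EQle.
set A := [set w | _] => PA.
have mA : measurable A.
  have mW : measurable_fun setT W by apply/measurable_EFinP; exact: (measurable_int P).
  rewrite (_ : A = W @^-1` `[V / 4, +oo[%classic).
    by rewrite -[X in measurable X]setTI; exact: mW.
  by apply/seteqP; split => w; rewrite /A/= in_itv/= andbT.
have mAO : measurable (A `&` Omega) by exact: measurableI.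
set c := (V / 4) `^ (gamma / 2).
have c0 : 0 <= c by exact: powR_ge0.
apply: (@le_trans _ _ (c%:E * P (A `&` Omega))%E).
  rewrite EFinM lee_wpmul2l// (le_trans PA)//; exact: probability_setI_full.
rewrite unlock -(setIT (A `&` Omega)) -integral_indic// -ge0_integralZl//; last first.
  by apply/measurable_EFinP; exact: measurable_indic.
apply: le_integral_nonmeasurable => w; first by rewrite mule_ge0// lee_fin.
rewrite -EFinM lee_fin indicE; case: (boolP (w \in _)) => [|_]; last first.
  by rewrite mulr0 powR_ge0.
rewrite inE mulr1 => -[WV Ow].
set D := Delta _ _ _.
have D0 : 0 <= D by exact: Delta_ge0.
have D2 : V / 4 <= D ^+ 2.
  apply: le_trans WV _.
  apply: (@le_trans _ _ (`|\sum_j X j w - \sum_j Y j w| ^+ 2)); last first.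
    rewrite ler_sqr ?nnegrE//.
    exact: (@Delta_total_sum R (l2 R) (fun z => `|z|) n (fun j => X j w) (fun j => Y j w)).
  (* Only the coordinates of the block are kept; each is the distance of a point of the lattice to
     [S m w]. *)
  apply: le_trans (l2_sum_sqr_le _ k N); apply: ler_sum => m _.
  rewrite l2_coordB !l2_coord_sum.
  have [z zE] : exists z : int, \sum_(j < n.+1) X j w m = a * z%:~R.
    pose z j := sval (cid (lattice w Ow j m)).
    exists (\sum_(j < n.+1) z j); rewrite rmorph_sum mulr_sumr; apply: eq_bigr => j _.
    by rewrite /z; case: cid.
  exact: lattice_distance_ge zE.
rewrite /c (_ : D `^ gamma = (D ^+ 2) `^ (gamma / 2)); last first.
  by rewrite -powR_mulrn// -powRrM mulrCA divff ?mulr1.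
by apply: ge0_ler_powR; rewrite ?nnegrE ?divr_ge0 ?sqr_ge0// ltW.
Qed.

End lower_bounds.

(** * What a construction for Z says about the coordinates of the X's and Y's *)

Section construction.
Context {R : realType} (s2 : nat -> R) (a : R).
Hypothesis s20 : forall i, 0 <= s2 i.
Hypothesis cs2 : cvgn (series s2).
Hypothesis a0 : 0 < a.
Hypothesis sa : limn (series s2) <= a ^+ 2.

Let Z := signed_atom_RV s2 a s20 cs2 a0 sa.

Context d (T : measurableType d) (P : probability T R) (n : nat)
  (X Y : 'I_n.+1 -> {RV P >-> l2 R}).
Hypothesis XYZ : is_construction Z X Y.

(** Z always lies in the Borel set [L] of vectors with coordinates 0, a or -a. Equality of laws puts
    each [X j] in [L] with probability 1, and the product rule does so for all [j] at once. *)
Lemma construction_lattice : exists Omega : set T,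
  [/\ measurable Omega, P Omega = 1%E &
  forall w, Omega w -> forall j m, exists z : int, X j w m = a * z%:~R].
Proof.
case: XYZ => indX XZ _ _ _.
pose L := \bigcap_m ((fun x : l2 R => x m) @^-1` [set 0; a; - a]).
have mL : measurable L.
  apply: bigcapT_measurable => m; rewrite -[X in measurable X]setTI.
  apply: measurable_l2_coord => //.
  by do 2 apply: measurableU => //.
have PX j : P (X j @^-1` L) = 1%E.
  have := XZ j L mL; rewrite /distribution /pushforward => ->.
  rewrite (_ : _ @^-1` L = setT) ?probability_setT//.
  apply/seteqP; split => // w _ m _.
  change (([set 0; a; - a] : set R) (signed_atom a w m)).
  by case: (signed_atom_coord a w m) => ->; [left; left|left; right|right].
exists (\bigcap_(j in setT) X j @^-1` L); split.
- apply: fin_bigcap_measurable; first exact: finite_finset.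
  move=> j _; rewrite -[X in measurable X]setTI.
  exact: (measurable_funP (X j)).
- by rewrite (indX (fun=> L))// big1.
- move=> w Ow j m; case: (Ow j I m I) => [[|]|] /= ->.
  + by exists 0; rewrite mulr0.
  + by exists 1; rewrite mulr1.
  + by exists (-1); rewrite mulrN1.
Qed.

(** Unit vectors as test vectors turn the weak mean and the covariance form into coordinate moments;
    as the mean is 0, the variance is the raw second moment. *)
Lemma construction_gaussian_moments j m :
  [/\ gaussian_real P (fun w => Y j w m),
      ('E_P[fun w => Y j w m] = 0)%E &
      (\int[P]_w (Y j w m ^+ 2)%:E = (s2 m)%:E)%E].
Proof.
case: XYZ => _ _ _ gY /(_ j)[meanY covY].
have coordY : (fun w => l2_dot (Y j w) (l2_unit m)) = (fun w => Y j w m).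
  by apply/funext => w; rewrite l2_dot_unitr.
have EY : ('E_P[fun w => Y j w m] = 0)%E.
  by have := meanY (l2_unit m); rewrite coordY l2_dot0l.
split => //; first by have := gY j (l2_unit m); rewrite coordY.
have coordZ : (fun w => l2_dot (Z w) (l2_unit m)) = (fun w => signed_atom a w m).
  by apply/funext => w; rewrite l2_dot_unitr.
have := congr1 (fun F => F (l2_unit m) (l2_unit m)) covY.
rewrite /cov_form coordY coordZ (signed_atom_variance s2 a s20 cs2 a0 sa m) => <-.
rewrite covariance.unlock EY expectation.unlock /=; apply: eq_integral => w _.
by rewrite -[RHS]/((Y j w m - 0) * (Y j w m - 0))%:E subr0 expr2.
Qed.

End construction.

(** * A finite block carrying half of the tail sum, the choice of constants and the final bound *)

Lemma tail_sum_ge_half {R : realType} (s2 : nat -> R) k :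
  (forall m, 0 < s2 m) -> cvgn (series s2) ->
  let B := limn (fun N => \sum_(k <= m < N) s2 m) in
  0 < B /\ exists2 N, (k < N)%N & B / 2 <= \sum_(k <= m < N) s2 m.
Proof.
move=> s20 cs2; set u := fun N => _ => /=.
have cu : cvgn u.
  have nd : nondecreasing_seq u.
    apply/nondecreasing_seqP => N; rewrite /u.
    have [kN|Nk] := leqP k N; first by rewrite big_nat_recr//= lerDl ltW.
    by rewrite !big_geq// ltnW.
  apply: nondecreasing_is_cvgn => //; exists (limn (series s2)) => _ [N _ <-].
  have ge0 i j : 0 <= \sum_(i <= m < j) s2 m by apply: sumr_ge0 => m _; exact: ltW.
  have ndS : nondecreasing_seq (series s2).
    by apply/nondecreasing_seqP => M; rewrite /series/= big_nat_recr//= lerDl ltW.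
  apply: le_trans (nondecreasing_cvgn_le ndS cs2 N); rewrite /u /series/=.
  have [kN|Nk] := leqP k N; last by rewrite big_geq// ltnW.
  by rewrite [leRHS](@big_cat_nat _ _ _ k)//= lerDr.
have lim_gt0 : 0 < limn u.
  apply: (@lt_le_trans _ _ (s2 k)) => //.
  apply: limr_ge => //; exists k.+1 => // N /= kN.
  by rewrite /u big_ltn// lerDl; apply: sumr_ge0 => m _; exact: ltW.
split => //; have : \forall N \near \oo, limn u / 2 < u N.
  by apply: (cvgr_gt _ cu); lra.
(* The maximum with [k.+1] keeps the block nonempty. *)
move=> [N0 _ hN]; exists (maxn N0 k.+1); first by rewrite leq_max ltnSn orbT.
by apply/ltW/hN; rewrite /= leq_maxl.
Qed.

Theorem theorem7 (R : realType) :
  exists c : R -> R,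
    (forall gamma : R, 0 <= gamma -> 0 < c gamma) /\
    forall (sigma : nat -> R) (n : nat) (lambda : R) (k : nat),
      (forall m, 0 < sigma m ^+ 2) ->
      (forall m, sigma m.+1 ^+ 2 <= sigma m ^+ 2) ->
      cvgn (series (fun m => sigma m ^+ 2)) ->
      (0 < n)%N ->
      0 < lambda ->
      sigma 0%N ^+ 2 <= lambda ^+ 2 ->
      n%:R * sigma k ^+ 2 < lambda ^+ 2 ->
      (forall m, n%:R * sigma m ^+ 2 < lambda ^+ 2 -> (k <= m)%N) ->
      let B2 : R := limn (fun N => \sum_(k <= m < N) sigma m ^+ 2) in
      exists (d0 : measure_display) (T0 : measurableType d0)
             (P0 : probability T0 R) (Z : {RV P0 >-> l2 R}),
        [/\ has_mean Z 0,
            forall i j : nat, i <> j ->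
              covariance P0 (fun w => Z w i) (fun w => Z w j) = 0%E,
            forall m : nat,
              'E_P0[fun w => (Z w m ^+ 2)%R]%E = (sigma m ^+ 2)%:E,
            forall gamma : R, 0 <= gamma ->
              ('E_P0[fun w => (`|Z w| `^ gamma)%R] < +oo)%E &
            forall gamma : R, 0 <= gamma ->
            forall (d : measure_display) (T : measurableType d)
                   (P : probability T R) (X Y : 'I_n -> {RV P >-> l2 R}),
              is_construction Z X Y ->
              ((c gamma)%:E *
                 ((if k == 0%N then 0 else
                     'E_P[fun w => (Delta (@eucl_norm R k)
                            (fun j => first_coords k (X j w))
                            (fun j => first_coords k (Y j w)) `^ gamma)%R]) +
                  ((n%:R * B2) `^ (gamma / 2))%R%:E)
               <= 'E_P[fun w => (Delta (fun x : l2 R => `|x|)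
                         (fun j => X j w) (fun j => Y j w) `^ gamma)%R])%E].
Proof.
have [C0 C01 gaussC] := @gaussian_fourth_moment_le R.
(* Large enough both for the Gaussian fourth moments and for passing to sums, where [3 <= C] is
   required. *)
pose C := C0 + 3; have C3 : 3 <= C by rewrite /C; lra.
have Cgt0 : 0 < C by lra.
(* The 8 comes from V / 4 with V at least half of n B_k^2; the factor 1 / (16 C) is the
   Paley-Zygmund probability. *)
pose q (gamma : R) := (8^-1 `^ (gamma / 2)) / (16 * C).
have q0 gamma : 0 < q gamma by rewrite divr_gt0 ?powR_gt0 ?mulr_gt0.
exists (fun gamma => Num.min 1 (q gamma) / 2); split => [gamma _|].
  by rewrite divr_gt0// lt_min ltr01 q0.
move=> sigma n lambda k s20 s2dec cs2 n0 _ _ _ _ B2.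
pose s2 m := sigma m ^+ 2.
have s2ge0 m : 0 <= s2 m by exact: sqr_ge0.
have ndS : nondecreasing_seq (series s2).
  by apply/nondecreasing_seqP => M; rewrite /series/= big_nat_recr//= lerDl.
have s2le m : s2 m <= limn (series s2).
  apply: le_trans (nondecreasing_cvgn_le ndS cs2 m.+1).
  by rewrite /series/= big_nat_recr//= lerDr sumr_ge0.
have L0 : 0 < limn (series s2) by exact: lt_le_trans (s20 0%N) (s2le 0%N).
case: n n0 => // n _.
have nC : 1 <= 8 * C * n.+1%:R.
  have : 1 <= n.+1%:R :> R by rewrite ler1n.
  by have := C3; nra.
(* Chosen so that 8 C n sigma_m^2 <= a^2 for all m, each sigma_m^2 being at most the total; it also
   gives total mass at most 1 to the nonzero atoms. *)
pose a := Num.sqrt (8 * C * n.+1%:R * limn (series s2)).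
have a2 : a ^+ 2 = 8 * C * n.+1%:R * limn (series s2).
  by rewrite sqr_sqrtr// mulr_ge0 ?(ltW L0)// (le_trans ler01).
have a0 : 0 < a by rewrite sqrtr_gt0 mulr_gt0// (lt_le_trans ltr01).
have sa : limn (series s2) <= a ^+ 2 by rewrite a2 ler_peMl// ltW.
have s2a m : 8 * C * (n.+1%:R * s2 m) <= a ^+ 2.
  by rewrite a2 mulrA ler_wpM2l// (le_trans ler01).
exists _, nat, (signed_atom_measure s2 a s2ge0 a0 sa), (signed_atom_RV s2 a s2ge0 cs2 a0 sa).
split.
- exact: signed_atom_mean.
- by move=> i j; exact: signed_atom_covariance.
- exact: signed_atom_coord_second_moment.
- exact: signed_atom_norm_moment.
move=> gamma g0 d T P X Y XYZ.
have [Om [mO PO lattice]] := construction_lattice _ _ _ _ _ _ _ _ _ _ _ _ XYZ.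
have mom := construction_gaussian_moments _ _ _ _ _ _ _ _ _ _ _ _ XYZ.
have [/ltW B20 [N kN BN]] := tail_sum_ge_half s2 k s20 cs2.
rewrite -/B2 in B20 BN.
have indY : independent_RVs Y by case: XYZ.
have E4 j m : (\int[P]_w (Y j w m ^+ 4)%:E <= (C * s2 m ^+ 2)%:E)%E.
  have [gY _ E2] := mom j m; apply: le_trans (gaussC _ _ _ _ _ gY E2) _.
  by rewrite lee_fin ler_wpM2r ?sqr_ge0// /C; lra.
have := deviation_moment_ge _ _ _ P n X Y s2 a C gamma k N Om indY C3 a0 g0 s20 s2a
  (fun j m => let: And3 _ E1 _ := mom j m in E1)
  (fun j m => let: And3 _ _ E2 := mom j m in E2) E4 mO PO lattice kN _ erefl.
set V := _ * _; set E := 'E_P[_]%E => lowerV.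
have lowerB : ((q gamma)%:E * ((n.+1%:R * B2) `^ (gamma / 2))%:E <= E)%E.
  apply: le_trans lowerV; rewrite -EFinM lee_fin /q mulrAC ler_wpM2r//.
    by rewrite invr_ge0 mulr_ge0// ltW.
  rewrite -powRM ?mulr_ge0//; apply: ge0_ler_powR; rewrite ?nnegrE ?divr_ge0 ?mulr_ge0//.
    by rewrite sumr_ge0.
  have := ler_wpM2l (ler0n R n.+1) BN; rewrite -/V; lra.
have E0 : (0 <= E)%E by apply: expectation_ge0 => w; exact: powR_ge0.
set A : \bar R := if _ then _ else _.
have A0 : (0 <= A)%E.
  rewrite /A; case: (k == 0%N); first exact: lexx.
  by apply: expectation_ge0 => w; exact: powR_ge0.
(* Dropping coordinates decreases every norm, hence also the maximum. *)
have AE : (A <= E)%E.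
  rewrite /A; case: (k == 0%N); first exact: E0.
  rewrite /E expectation.unlock.
  apply: le_integral_nonmeasurable => w; first by rewrite lee_fin powR_ge0.
  rewrite lee_fin; apply: ge0_ler_powR; rewrite ?nnegrE ?Delta_ge0//.
  exact: Delta_first_coords_le.
set b := (_ `^ (gamma / 2))%R; have b0 : 0 <= b by exact: powR_ge0.
set c := Num.min 1 (q gamma).
have c0 : 0 <= c by rewrite le_min ler01 ltW.
(* One half of [E] pays for the first [k] coordinates with constant 1, the other for the tail with
   constant [q gamma]. Nonnegativity justifies the splitting even for infinite [E]. *)
have half : (E = (2^-1)%:E * E + (2^-1)%:E * E)%E.
  rewrite -ge0_muleDl// -EFinD (_ : 2^-1 + 2^-1 = 1 :> R) ?mul1e//; lra.
rewrite [leRHS]half ge0_muleDr//.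
have -> : c / 2 = 2^-1 * c by rewrite mulrC.
rewrite EFinM -!muleA; apply: leeD; rewrite lee_wpmul2l ?lee_fin//.
  apply: le_trans AE; rewrite -[leRHS]mul1e lee_wpmul2r// lee_fin.
  by rewrite ge_min lexx.
apply: le_trans lowerB; rewrite lee_wpmul2r ?lee_fin//.
by rewrite ge_min lexx orbT.
Qed.
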